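(* Let $A$ be a finite set and let $\theta:\mathcal E\to\mathbb R$ be an integrable weight on the set $\mathcal E=\mathcal E_A$ of undirected edges of $A$. Let $\mu=\mu_{1/2}$ denote the distribution at time $t=1/2$ of the corresponding loop soup, considered as a (signed) measure on the set $\mathcal C$ of undirected currents. Then for every $\bar k=(k_e)_{e\in\mathcal E}\in\mathcal C$, $$\mu(\bar k)=\sqrt{D}\,\left[\prod_{x\in A}\frac{\Gamma(n_x+\frac12)}{\sqrt\pi}\right]\left[\prod_{e\in\mathcal E}\frac1{k_e!}\right]\theta(\bar k),$$ where $n_x=n_x(\bar k)$ is the vertex local time of $\bar k$ at $x$, $\theta(\bar k)=\prod_{e\in\mathcal E}\theta_e^{k_e}$, and $D=\det(I-Q)$.
   Context: $\mathbb N=\{0,1,2,\dots\}$. $\mathcal E=\mathcal E_A$ is the set of all unordered pairs $\{x,y\}$ of elements of $A$, including self-edges ($x=y$). A real signed weight $\theta$ on $\mathcal E$ corresponds to the symmetric weight $q$ on directed edges $A\times A$ given by $q(x,y)=\theta_{xy}/2$ if $x\ne y$ and $q(x,x)=\theta_{xx}$; put $Q=[q(x,y)]_{x,y\in A}$. The weight $\theta$ is integrable if the matrix $[|q(x,y)|]$ has spectral radius strictly less than $1$. Vertex local time: for $\bar k\in\mathbb N^{\mathcal E}$, $n_x(\bar k)=\frac12\sum_{e\in\mathcal E}k_e\,n_e(x)$, where $n_e(x)=2$ if $e$ is a self-edge at $x$, $n_e(x)=1$ if $e$ joins $x$ to a different vertex, and $n_e(x)=0$ otherwise. $\bar k$ is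 an (undirected) current if $n_x(\bar k)$ is an integer for every $x\in A$; $\mathcal C$ is the set of currents. Loops: a (nontrivial) rooted loop is a sequence $l=[l_0,l_1,\dots,l_n]$ in $A$ with $n\ge1$, $l_n=l_0$; $|l|=n$ and $q(l)=\prod_{j=1}^n q(l_{j-1},l_j)$. An unrooted (oriented) loop $\ell$ is an equivalence class of nontrivial rooted loops under cyclic shift of the root, $[l_0,l_1,\dots,l_n]\sim[l_1,\dots,l_n,l_1]\sim\cdots$; $|\ell|,q(\ell)$ are the common values for its representatives and $s_\ell$ is the number of distinct representatives. $\mathcal L(A)$ is the set of unrooted loops. The unrooted loop measure is $m(\ell)=s_\ell\,q(\ell)/|\ell|$. Loop soup: at time $t$, the distribution of the soup is the (signed) measure $\nu_t$ on finite multisets $\overline N:\mathcal L(A)\to\mathbb N$ (finitely many nonzero values) given by $\nu_t[\overline N]=e^{-t\,m(\mathcal L(A))}\prod_{\ell\in\mathcal L(A)}\frac{(t\,m(\ell))^{N(\ell)}}{N(\ell)!}$ (for nonnegative $\theta$ this is the law at time $t$ of independent Poisson processes with rates $m(\ell)$). Each multiset $\overline N$ determines a current $\bar k$ by letting $k_e$ be the total number of traversals (in either direction) of the edge $e$ by all loops of the multiset, counted with multiplicity. $\mu_t$ is the image of $\nu_t$ under this map. *)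

(* Defs.v *)
From HB Require Import structures.
From mathcomp Require Import all_boot all_order all_algebra generic_quotient.
From mathcomp Require Import finmap multiset complex.
From mathcomp Require Import all_classical all_reals all_analysis.

Set Implicit Arguments.
Unset Strict Implicit.
Unset Printing Implicit Defensive.

Import Order.TTheory GRing.Theory Num.Theory.
Import numFieldNormedType.Exports.

Local Open Scope classical_set_scope.
Local Open Scope mset_scope.
Local Open Scope ring_scope.

(* The sum of f over D, for absolutely summable f; meaningless when
   [summable D (EFin \o f)] fails. *)
Definition signed_sum (R : realType) (T : choiceType) (D : set T)
    (f : T -> R) : R :=
  fine (\esum_(x in D) (EFin \o f)^\+ x - \esum_(x in D) (EFin \o f)^\- x)%E.

Definition spectral_radius (R : realType) (n : nat) (M : 'M[R]_n) : R :=
  sup [set ComplexField.Normc.normc z | z in [set z : R[i] |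
    eigenvalue (map_mx (real_complex R) M) z]].

Definition Gamma (R : realType) (s : R) : R :=
  \int[lebesgue_measure]_(t in `]0, +oo[) (t `^ (s - 1) * expR (- t)).

(* Unordered pairs {x, y} are the subsets of cardinality 1 (self-edges, x = y)
   or 2. *)
Definition edge (A : finType) := {e : {set A} | (0 < #|e| <= 2)%N}.

HB.instance Definition _ (A : finType) := SubFinite.on (edge A).

Lemma edge_of_subproof (A : finType) (x y : A) :
  (0 < #|[set x; y]%SET| <= 2)%N.
Proof. by rewrite cards2; case: (x != y). Qed.

Definition edge_of (A : finType) (x y : A) : edge A :=
  Sub [set x; y]%SET (edge_of_subproof x y).

Definition edge_deg (A : finType) (e : edge A) (x : A) : nat :=
  if x \in val e then if #|val e| == 1%N then 2%N else 1%N else 0%N.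

Definition local_time (R : realType) (A : finType) (k : {ffun edge A -> nat})
    (x : A) : R :=
  2^-1 * \sum_(e : edge A) (k e * edge_deg e x)%:R.

Definition is_current (R : realType) (A : finType) (k : {ffun edge A -> nat})
    : Prop :=
  forall x : A, local_time R k x \is a Num.int.

Section Weight.
Variables (R : realType) (A : finType) (theta : edge A -> R).

Definition dir_weight (x y : A) : R :=
  if x == y then theta (edge_of x y) else theta (edge_of x y) / 2.

Definition weight_mx : 'M[R]_#|A| :=
  \matrix_(i, j) dir_weight (enum_val i) (enum_val j).

Definition integrable_weight : Prop :=
  spectral_radius (map_mx Num.norm weight_mx) < 1.

End Weight.

(* The rooted loop [l_0, l_1, ..., l_n] with l_n = l_0 and n >= 1 is encoded by
   the nonempty sequence [:: l_0; ...; l_(n-1)]: the final return to l_0 is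
   implicit, |l| is the size, and moving the root is [rot 1]. *)
Definition rooted_loop (A : finType) := {l : seq A | l != [::]}.

HB.instance Definition _ (A : finType) := SubChoice.on (rooted_loop A).

Section Rooted.
Variable A : finType.
Implicit Types l : rooted_loop A.

(* The directed edges (l_(j-1), l_j), 1 <= j <= n. *)
Definition loop_steps l : seq (A * A) := zip (val l) (rot 1 (val l)).

Definition root_shifts l : seq (seq A) :=
  [seq rot i (val l) | i <- iota 0 (size (val l))].

Definition same_loop : rel (rooted_loop A) :=
  fun l l' => val l' \in root_shifts l.

Lemma same_loopP l l' :
  reflect (exists i, val l' = rot i (val l)) (same_loop l l').
Proof.
apply: (iffP mapP) => [[i _ ->]|[i ->]]; first by exists i.
case: (ltnP i (size (val l))) => hi; first by exists i; rewrite ?mem_iota.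
exists 0%N; last by rewrite rot0 rot_oversize.
by rewrite mem_iota /= lt0n size_eq0 (valP l).
Qed.

Lemma same_loop_refl : reflexive same_loop.
Proof. by move=> l; apply/same_loopP; exists 0%N; rewrite rot0. Qed.

Lemma same_loop_sym : symmetric same_loop.
Proof.
suff H l l' : same_loop l l' -> same_loop l' l by move=> l l'; apply/idP/idP; apply: H.
move=> /same_loopP[i h]; apply/same_loopP; exists (size (val l') - i)%N.
by rewrite h size_rot -[LHS](rotK i) /rotr size_rot.
Qed.

Lemma same_loop_trans : transitive same_loop.
Proof.
move=> l' l l'' /mapP[i + h] /mapP[j + h'].
rewrite h size_rot !mem_iota /= !add0n => /ltnW hi /ltnW hj.
by apply/same_loopP; rewrite h' h rot_add_mod //; eexists; reflexivity.
Qed.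

Canonical same_loop_equiv :=
  EquivRel same_loop same_loop_refl same_loop_sym same_loop_trans.

End Rooted.

Definition loop (A : finType) := {eq_quot (same_loop_equiv A)}%qT.

HB.instance Definition _ (A : finType) := Choice.on (loop A).
HB.instance Definition _ (A : finType) := EqQuotient.on (loop A).

(* Each quantity below is invariant under moving the root, hence independent of
   the representative [repr l]. *)
Section Loops.
Variables (R : realType) (A : finType) (theta : edge A -> R).

Definition loop_length (l : loop A) : nat := size (val (repr l)).

Definition loop_weight (l : loop A) : R :=
  \prod_(p <- loop_steps (repr l)) dir_weight theta p.1 p.2.

(* The number of distinct representatives. *)
Definition loop_reps (l : loop A) : nat := size (undup (root_shifts (repr l))).

Definition traversals (l : loop A) (e : edge A) : nat :=
  count (fun p => edge_of p.1 p.2 == e) (loop_steps (repr l)).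

Definition loop_measure (l : loop A) : R :=
  (loop_reps l)%:R * loop_weight l / (loop_length l)%:R.

(* The product over all loops is restricted to the support of N: the other
   factors are equal to 1. *)
Definition soup (t : R) (N : {mset loop A}) : R :=
  expR (- (t * signed_sum [set: loop A] loop_measure)) *
  \prod_(l <- finsupp N) ((t * loop_measure l) ^+ N l / (N l)`!%:R).

Definition soup_current (N : {mset loop A}) : {ffun edge A -> nat} :=
  [ffun e => (\sum_(l <- finsupp N) N l * traversals l e)%N].

Definition current_soup (t : R) (k : {ffun edge A -> nat}) : R :=
  signed_sum (soup_current @^-1` [set k]) (soup t).

End Loops.

(* Main.v *)
(** For a current k, let c(k) be the sum of prod_l (t m(l))^N(l) / N(l)! over the
    finitely many loop multisets N of current k, so that
    mu(k) = exp(-t m(L(A))) c(k).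

    The combinatorial factor is computed at t = 1/2 from a recursion. Removing a
    loop from a multiset gives
      k_e c(k) = t sum_l (traversals of e by l) m(l) c(k - current of l),
    and rooting l at one of its traversals of e cancels the factor 1/|l| in m(l).
    Hence, with H(x, y; k) the sum over paths p from x to y of
    q(p) c(k - current of p),
      k_e c(k) = t sum_{(x, z) : {x, z} = e} q(x, z) H(z, x; k - e),
      H(x, y; k) = [x = y] c(k) + sum_z q(x, z) H(z, y; k - {x, z}).
    These determine c and H by induction on |k|; where the arguments of w below are
    integers, the solution is
      c(k) = prod_x w(n_x) prod_e theta_e^k_e / k_e!,
      H(a, b; k) = 2 prod_x w(n_x + ([x = a] + [x = b]) / 2) prod_e theta_e^k_e / k_e!
    with w(n) = Gamma(n + 1/2) / sqrt(pi), because w(n + 1) = (n + 1/2) w(n).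

    For the normalization, m(L(A)) = sum_n tr(Q^n) / n. As Q and |Q| are symmetric,
    the spectral theorem gives tr(|Q|^n) <= #|A| rho^n with rho < 1; hence the
    eigenvalues d_i of Q lie in ]-1, 1[ and m(L(A)) = - sum_i ln (1 - d_i). *)
Require Import Defs.
From mathcomp Require Import all_boot all_order all_algebra finmap multiset.
From mathcomp Require Import all_classical all_reals all_analysis.
From mathcomp Require Import complex measurable_realfun ring lra zify.
From mathcomp Require Import mxpoly sesquilinear spectral.

Set Implicit Arguments.
Unset Strict Implicit.
Unset Printing Implicit Defensive.

Import Order.TTheory GRing.Theory Num.Theory.
Import numFieldNormedType.Exports.

Local Open Scope classical_set_scope.
Local Open Scope mset_scope.
Local Open Scope ring_scope.

(** * Half-integer values of the Gamma function *)

Section GammaFunction.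
Variable R : realType.
Implicit Types (s t x : R) (k n : nat).

Let mu := @lebesgue_measure R.

Definition Gamma_integrand s t : R := t `^ (s - 1) * expR (- t).

Lemma Gamma_integrand_ge0 s t : 0 <= Gamma_integrand s t.
Proof. by rewrite mulr_ge0 ?powR_ge0 ?expR_ge0. Qed.

Lemma measurable_Gamma_integrand s : measurable_fun setT (Gamma_integrand s).
Proof.
apply: measurable_funM; first exact: measurable_powR.
exact: (measurableT_comp (@measurable_expR R)).
Qed.

(** Compact intervals away from 0, where integration by parts and substitution apply even if the
    integrand is singular at 0. The exponent [k] is there because t = u^2 carries [exhaustion 1 n]
    onto [exhaustion 2 n]. *)
Definition exhaustion k n : set R := `[n.+1%:R^-1 ^+ k, n.+1%:R ^+ k].

Lemma bigcup_exhaustion k : \bigcup_n exhaustion k.+1 n = `]0%R, +oo[%classic.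
Proof.
apply/seteqP; split => x /=.
  move=> [n _]; rewrite /exhaustion /= in_itv /= => /andP[nx _].
  by rewrite in_itv /= andbT (lt_le_trans _ nx)// exprn_gt0// invr_gt0.
(* An index with n + 1 > x + 1/x dominates both x and 1/x. *)
rewrite in_itv /= andbT => x0; pose n := Num.truncn (x + x^-1).
have nx : x + x^-1 < n.+1%:R by rewrite truncnS_gt.
exists n => //; rewrite /exhaustion /= in_itv /=; apply/andP; split.
  rewrite exprVn -[leRHS]invrK lef_pV2 ?posrE ?invr_gt0 ?exprn_gt0//.
  apply: (@le_trans _ _ n.+1%:R).
    by apply: le_trans (ltW nx); rewrite lerDr ltW.
  by rewrite exprS ler_peMr ?exprn_ege1 ?ler1n.
apply: (@le_trans _ _ n.+1%:R).
  by apply: le_trans (ltW nx); rewrite lerDl invr_ge0 ltW.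
by rewrite exprS ler_peMr ?exprn_ege1 ?ler1n.
Qed.

Lemma nondecreasing_exhaustion k : nondecreasing_seq (exhaustion k).
Proof.
move=> m n mn; apply/subsetPset => x; rewrite /exhaustion /= !in_itv /=.
move=> /andP[mx xm]; apply/andP; split.
  apply: le_trans mx; rewrite lerXn2r ?nnegrE ?invr_ge0//.
  by rewrite lef_pV2 ?posrE// ler_nat ltnS.
by apply: (le_trans xm); rewrite lerXn2r ?nnegrE// ler_nat ltnS.
Qed.

Lemma cvg_integral_exhaustion k (f : R -> R) : (forall x, 0 <= f x) ->
  measurable_fun setT f ->
  (\int[mu]_(x in exhaustion k.+1 n) (f x)%:E @[n --> \oo] -->
   \int[mu]_(x in `]0%R, +oo[) (f x)%:E)%E.
Proof.
move=> f0 mf; rewrite -(bigcup_exhaustion k).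
apply: ge0_nondecreasing_set_cvg_integral.
- exact: nondecreasing_exhaustion.
- by move=> n; exact: measurable_itv.
- by move=> n; apply/measurable_EFinP/measurable_funTS.
- by move=> n x _; rewrite lee_fin.
Qed.

Lemma GammaE s : Gamma s = fine (\int[mu]_(t in `]0%R, +oo[) (Gamma_integrand s t)%:E).
Proof. by []. Qed.

Lemma derivable_pos_LRcontinuous (F : R -> R) (a b : R) : 0 < a -> a <= b ->
  (forall x, 0 < x -> derivable F x 1) -> derivable_oo_LRcontinuous F a b.
Proof.
move=> a0 ab dF; have cF x : 0 < x -> {for x, continuous F}.
  by move=> /dF/derivable1_diffP/differentiable_continuous.
split.
- by move=> x; rewrite in_itv/= => /andP[ax _]; apply/dF/(lt_trans a0).
- by apply/cvg_at_right_filter/cF.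
- by apply/cvg_at_left_filter/cF/(lt_le_trans a0).
Qed.

Lemma integral_Gamma_parts s n : 0 < s ->
  (\int[mu]_(t in exhaustion 1 n) (Gamma_integrand (s + 1) t)%:E =
   ((n.+1%:R^-1 `^ s) * expR (- n.+1%:R^-1) - n.+1%:R `^ s * expR (- n.+1%:R))%:E +
   s%:E * \int[mu]_(t in exhaustion 1 n) (Gamma_integrand s t)%:E)%E.
Proof.
move=> s0; rewrite /exhaustion !expr1.
(* For n = 0 the interval is the point 1, while integration by parts asks for distinct endpoints. *)
have [->|n0] := posnP n.
  by rewrite invr1 !set_itv1 !integral_set1 subrr mule0 adde0.
have a0 : 0 < n.+1%:R^-1 :> R by rewrite invr_gt0.
have ab : n.+1%:R^-1 < n.+1%:R :> R.
  by rewrite (@lt_trans _ _ 1)// ?ltr1n// invf_lt1// ltr1n.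
have dpow x : 0 < x -> is_derive x 1 (fun t => t `^ s) (s * x `^ (s - 1)).
  exact: is_derive1_powR.
have dexp x : is_derive x 1 (fun t : R => - expR (- t)) (expR (- x)).
  by apply: is_derive_eq; rewrite /GRing.scale /=; ring.
have cpow r : {within `[n.+1%:R^-1, n.+1%:R], continuous (fun t : R => t `^ r)}.
  apply: derivable_within_continuous => x; rewrite in_itv/= => /andP[ax _].
  exact/ex_derive/is_derive1_powR/(lt_le_trans a0).
have := @integration_by_parts R (fun t => t `^ s) (fun t => - expR (- t))
  (fun t => s * t `^ (s - 1)) (fun t => expR (- t)) _ _ ab.
rewrite /Gamma_integrand addrK => ->.
- under eq_integral do rewrite mulrN EFinN -mulrA EFinM.
  have pos t : (0 <= (t `^ (s - 1) * expR (- t))%:E)%E.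
    by rewrite lee_fin Gamma_integrand_ge0.
  rewrite integral_ge0N; last first.
    by move=> t _; rewrite mule_ge0// lee_fin ltW.
  rewrite oppeK ge0_integralZl//; first last.
  - by rewrite lee_fin ltW.
  - by apply/measurable_EFinP/measurable_funTS; exact: measurable_Gamma_integrand.
  by congr (_%:E + _)%E; rewrite !mulrN opprK addrC.
- have cs : {within `[n.+1%:R^-1, n.+1%:R], continuous (fun _ : R => s)}.
    by apply: continuous_subspaceT => x; exact: cvg_cst.
  by move=> x; apply: cvgM; [exact: cs|exact: cpow].
- by apply: derivable_pos_LRcontinuous => // [|x /dpow []//]; exact: ltW.
- move=> x; rewrite in_itv/= => /andP[ax _]; rewrite derive1E.
  by have [_ ->] := dpow _ (lt_trans a0 ax).
- by apply: derivable_within_continuous => x _; apply: ex_derive.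
- by apply: derivable_pos_LRcontinuous => //; exact: ltW.
- by move=> x _; rewrite derive1E; have [_ ->] := dexp x.
Qed.

Lemma cvg_Gamma_boundary s : 0 < s ->
  (n.+1%:R^-1 `^ s) * expR (- n.+1%:R^-1) - n.+1%:R `^ s * expR (- n.+1%:R)
    @[n --> \oo] --> (0 : R).
Proof.
move=> s0; rewrite -[X in _ --> X]subr0; apply: cvgB.
  apply: (@squeeze_cvgr _ _ _ _ (fun=> 0) (fun n => n.+1%:R^-1 `^ s)).
  - apply: nearW => n; rewrite mulr_ge0 ?powR_ge0 ?expR_ge0//=.
    by rewrite ler_piMr ?powR_ge0// -expR0 ler_expR oppr_le0.
  - exact: cvg_cst.
  - have inv0 : n.+1%:R^-1 @[n --> \oo] --> (0 : R)^'+.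
      move=> P /(@cvg_harmonic R) [N _ NP]; exists N => // n /NP; apply.
      by rewrite /= invr_gt0.
    exact: (cvg_comp _ _ inv0 (powR_cvg0 s0)).
(* With N = n + 1 and s <= k + 1, the bound exp N >= N^(k+2) / (k+2)! gives N^s exp(-N) <= (k+2)! /
   N. *)
pose k := Num.truncn s.
have sk : s <= k.+1%:R by rewrite ltW// truncnS_gt.
apply: (@squeeze_cvgr _ _ _ _ (fun=> 0) (fun n => k.+2`!%:R / n.+1%:R)).
- apply: nearW => n; rewrite mulr_ge0 ?powR_ge0 ?expR_ge0//=.
  have pn : n.+1%:R `^ s <= n.+1%:R ^+ k.+1 :> R.
    by rewrite -powR_mulrn// ler_powR// ler1n.
  apply: le_trans (ler_wpM2r (expR_ge0 _) pn) _.
  have en : n.+1%:R ^+ k.+2 / k.+2`!%:R <= expR n.+1%:R :> R.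
    by apply: le_trans (expR_ge1Dxn k.+1 (ler0n _ _)); rewrite lerDr.
  rewrite expRN ler_pdivrMr ?expR_gt0// mulrAC ler_pdivlMr ?ltr0n// -exprSr.
  by rewrite mulrC -ler_pdivrMr ?ltr0n ?fact_gt0.
- exact: cvg_cst.
- by rewrite -[X in _ --> X](mulr0 k.+2`!%:R); apply: cvgMr; exact: cvg_harmonic.
Qed.

Lemma Gamma_integral_rec s : 0 < s ->
  (\int[mu]_(t in `]0%R, +oo[) (Gamma_integrand s t)%:E)%E \is a fin_num ->
  (\int[mu]_(t in `]0%R, +oo[) (Gamma_integrand (s + 1) t)%:E =
   s%:E * \int[mu]_(t in `]0%R, +oo[) (Gamma_integrand s t)%:E)%E.
Proof.
move=> s0 fin_s.
have := cvg_integral_exhaustion 0 (Gamma_integrand_ge0 (s + 1))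
  (measurable_Gamma_integrand (s + 1)).
rewrite (_ : (fun n => _) = (fun n =>
   ((n.+1%:R^-1 `^ s) * expR (- n.+1%:R^-1) - n.+1%:R `^ s * expR (- n.+1%:R))%:E +
   s%:E * \int[mu]_(t in exhaustion 1 n) (Gamma_integrand s t)%:E)%E); last first.
  by apply/funext => n; exact: integral_Gamma_parts.
move/cvg_unique; apply; first exact: ereal_hausdorff.
rewrite /= -[X in _ --> X]add0e; apply: cvgeD.
- by rewrite fin_num_adde_defl ?fin_numM.
- by apply: cvg_EFin; [exact: nearW|exact: cvg_Gamma_boundary].
- apply: cvgeZl => //.
  exact: (cvg_integral_exhaustion 0 (Gamma_integrand_ge0 s)
    (measurable_Gamma_integrand s)).
Qed.

(** Substitution t = u^2: the Jacobian 2u cancels t^(-1/2) = 1/u and leaves twice the Gaussian. *)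
Lemma integral_Gamma_half_substitution n :
  (\int[mu]_(t in exhaustion 2 n) (Gamma_integrand 2^-1 t)%:E =
   2%:E * \int[mu]_(t in exhaustion 1 n) (gauss_fun t)%:E)%E.
Proof.
rewrite /exhaustion !expr1.
have a0 : 0 < n.+1%:R^-1 :> R by rewrite invr_gt0.
have ab : n.+1%:R^-1 <= n.+1%:R :> R.
  by rewrite (@le_trans _ _ 1)// ?ler1n// invf_le1// ler1n.
have dsq x : is_derive x 1 (fun t : R => t ^+ 2) (2 * x).
  by apply: is_derive_eq; rewrite /GRing.scale /=; ring.
have dsqE : (fun t : R => t ^+ 2)^`()%classic = (fun t => 2 * t).
  by apply/funext => x; rewrite derive1E; have [_ ->] := dsq x.
have cdsq x : {for x, continuous (fun t : R => 2 * t)}.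
  by apply: cvgMr; exact: cvg_id.
have := @integration_by_substitution_increasing R (fun t => t ^+ 2)
  (Gamma_integrand 2^-1) _ _ ab.
rewrite dsqE => -> //.
- rewrite -ge0_integralZl//; last 2 first.
  + by apply/measurable_EFinP/measurable_funTS; exact: measurable_gauss_fun.
  + by move=> x _; rewrite lee_fin gauss_fun_ge0.
  apply: eq_integral => x; rewrite inE /= in_itv/= => /andP[ax _].
  have x0 : 0 < x := lt_le_trans a0 ax.
  rewrite -EFinM; congr (_%:E); rewrite /= /Gamma_integrand /gauss_fun fctE /=.
  have -> : 2^-1 - 1 = - 2^-1 :> R by field.
  rewrite powRN powR12_sqrt ?sqr_ge0// sqrtr_sqr gtr0_norm//.
  by field; rewrite gt_eqF.
- move=> x y; rewrite !in_itv/= => /andP[ax _] /andP[ay _] xy.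
  have x0 := lt_le_trans a0 ax; have y0 := lt_le_trans a0 ay.
  by rewrite ltr_pXn2r ?nnegrE ?(ltW x0) ?(ltW y0).
- by move=> x _; exact: cdsq.
- by apply/cvg_ex; eexists; apply/cvg_at_right_filter/cdsq.
- by apply/cvg_ex; eexists; apply/cvg_at_left_filter/cdsq.
- by apply: derivable_pos_LRcontinuous => // x _; have [] := dsq x.
apply: derivable_within_continuous => x; rewrite in_itv/= => /andP[ax _].
have x0 : 0 < x by rewrite (lt_le_trans _ ax)// exprn_gt0.
apply: derivableM; first exact/ex_derive/is_derive1_powR.
exact: ex_derive.
Qed.

Lemma Gamma_integral_half :
  (\int[mu]_(t in `]0%R, +oo[) (Gamma_integrand 2^-1 t)%:E = (Num.sqrt pi)%:E)%E.
Proof.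
have := cvg_integral_exhaustion 1 (Gamma_integrand_ge0 2^-1)
  (measurable_Gamma_integrand 2^-1).
rewrite (_ : (fun n => _) = (fun n =>
   2%:E * \int[mu]_(t in exhaustion 1 n) (gauss_fun t)%:E)%E); last first.
  apply/funext => n; exact: integral_Gamma_half_substitution.
move/cvg_unique; apply; first exact: ereal_hausdorff.
rewrite /=; have -> : (Num.sqrt pi)%:E =
    (2%:E * \int[mu]_(t in `]0%R, +oo[) (gauss_fun t)%:E)%E.
  rewrite -[RHS](_ : (2%:E * \int[mu]_(t in `[0%R, +oo[) (gauss_fun t)%:E)%E = _).
    by rewrite integral0y_gauss -EFinM mulrCA divff ?mulr1// pnatr_eq0.
  congr (_ * _)%E; apply/esym/integral_itv_obnd_cbnd/measurable_EFinP/measurable_funTS.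
  exact: measurable_gauss_fun.
apply: cvgeZl => //; apply: (cvg_integral_exhaustion 0).
- exact: gauss_fun_ge0.
- exact: measurable_gauss_fun.
Qed.

Lemma Gamma_half : Gamma (2^-1 : R) = Num.sqrt pi.
Proof. by rewrite GammaE Gamma_integral_half. Qed.

(** [Gamma] is the [fine] of an extended real integral, so the recursion descends to real numbers
    only once this integral is known to be finite. *)
Lemma Gamma_integral_half_nat n :
  (\int[mu]_(t in `]0%R, +oo[) (Gamma_integrand (n%:R + 2^-1) t)%:E)%E \is a fin_num.
Proof.
elim: n => [|n IH]; first by rewrite add0r Gamma_integral_half.
by rewrite -natr1 addrAC Gamma_integral_rec ?fin_numM// ltr_wpDl.
Qed.

Lemma Gamma_half_rec n :
  Gamma (n.+1%:R + 2^-1 : R) = (n%:R + 2^-1) * Gamma (n%:R + 2^-1 : R).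
Proof.
rewrite !GammaE -natr1 addrAC Gamma_integral_rec ?Gamma_integral_half_nat ?ltr_wpDl//.
by rewrite fineM ?Gamma_integral_half_nat.
Qed.

End GammaFunction.

(** * Currents and edges *)

Section Currents.
Variable A : finType.
Implicit Types (k : {ffun edge A -> nat}) (e f : edge A) (x y z : A).

Definition current_size k : nat := (\sum_e k e)%N.

Definition drop_edge k e : {ffun edge A -> nat} := [ffun f => (k f - (f == e))%N].

(** Twice the local time. It stays in [nat], and k is a current exactly when all degrees are
    even. *)
Definition degree k x : nat := (\sum_e k e * edge_deg e x)%N.

Lemma drop_edgeK k e f : (0 < k e)%N -> (drop_edge k e f + (f == e))%N = k f.
Proof.
by move=> ke; rewrite ffunE; case: eqP => [->|_]; rewrite ?subnK ?subn0 ?addn0.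
Qed.

Lemma current_size_drop k e : (0 < k e)%N ->
  (current_size (drop_edge k e)).+1 = current_size k.
Proof.
move=> ke; rewrite /current_size -addn1.
have -> : 1%N = (\sum_f (f == e))%N.
  by rewrite (bigD1 e)//= eqxx big1 ?addn0// => f /negPf->.
by rewrite -big_split/=; apply: eq_bigr => f _; rewrite drop_edgeK.
Qed.

Lemma degree_drop k e x : (0 < k e)%N ->
  (degree (drop_edge k e) x + edge_deg e x)%N = degree k x.
Proof.
move=> ke; rewrite /degree.
have -> : edge_deg e x = (\sum_f (f == e) * edge_deg f x)%N.
  by rewrite (bigD1 e)//= eqxx mul1n big1 ?addn0// => f /negPf->.
by rewrite -big_split/=; apply: eq_bigr => f _; rewrite -mulnDl drop_edgeK.
Qed.

Lemma edge_ofC x y : edge_of x y = edge_of y x.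
Proof. by apply/val_inj; rewrite /= finset.setUC. Qed.

Lemma edge_deg_of x y z : edge_deg (edge_of x y) z = ((z == x) + (z == y))%N.
Proof.
rewrite /edge_deg /= !inE cards2.
have [<-|xy] := eqVneq x y; first by case: eqP.
by have [->|] := eqVneq z x; rewrite ?(negPf xy)//=; case: eqP.
Qed.

Lemma edge_of_inj x : injective (edge_of x).
Proof.
move=> y z /(congr1 val)/= /finset.setP E.
have /esym := E y; rewrite !inE eqxx orbT => /orP[/eqP yx|/eqP//].
by have := E z; rewrite !inE eqxx orbT yx orbb => /eqP.
Qed.

Lemma edge_of_endpoint x e : x \in val e -> exists y, e = edge_of x y.
Proof.
case: e => E E12 /= xE; have /andP[E0 E2] := E12.
have [Ex|/finset.set0Pn[y]] := eqVneq (E :\ x)%SET finset.set0.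
  exists x; apply/val_inj => /=; rewrite finset.setUid.
  by rewrite -(finset.setD1K xE) Ex finset.setU0.
rewrite finset.in_setD1 => /andP[yx yE]; exists y; apply/val_inj => /=; apply/esym/eqP.
rewrite eqEcard; apply/andP; split; first by rewrite finset.subUset !finset.sub1set xE.
by rewrite cards2 eq_sym yx.
Qed.

(** The map [edge_of x] is a bijection from the vertices to the edges at x, and the self-edge at x
    counts twice. *)
Lemma degree_endpoints k x :
  degree k x = (\sum_y (1 + (y == x)) * k (edge_of x y))%N.
Proof.
rewrite /degree (bigID (fun e : edge A => x \in val e))/=.
rewrite [X in (_ + X)%N]big1 ?addn0; last first.
  by move=> e /negPf xe; rewrite /edge_deg xe muln0.
have /(reindex_onto (edge_of x)) :
    forall e, x \in val e -> edge_of x (odflt x [pick y | e == edge_of x y]) = e.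
  move=> e /edge_of_endpoint[y ->]; case: pickP => [z /eqP ->//|/(_ y)].
  by rewrite eqxx.
move=> ->; apply: eq_big => [y|y _].
  rewrite /= !inE eqxx /=; case: pickP => [z /eqP/edge_of_inj <-/=|/(_ y)].
    by rewrite eqxx.
  by rewrite eqxx.
by rewrite edge_deg_of eqxx mulnC [x == y]eq_sym.
Qed.

End Currents.

(** * The recursion for current weights *)

Section WickRecursion.
Variables (R : realType) (A : finType) (theta : edge A -> R).
Implicit Types (k : {ffun edge A -> nat}) (e f : edge A) (x y z a b : A).

(** The factor 1 + [z = x] is the multiplicity of [degree_endpoints]; this match is what makes a sum
    over first steps produce a degree. *)
Lemma dir_weightE x z :
  dir_weight theta x z = theta (edge_of x z) * ((1 + (z == x))%:R / 2).
Proof.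
rewrite /dir_weight [z == x]eq_sym; case: eqP => _ /=; last by rewrite addn0 div1r.
by rewrite divff ?mulr1// pnatr_eq0.
Qed.

Lemma edge_deg_endpoints e x :
  edge_deg e x = (\sum_(z | edge_of x z == e) (1 + (z == x)))%N.
Proof.
have -> : edge_deg e x = degree [ffun f => nat_of_bool (f == e)] x.
  rewrite /degree (bigD1 e)//= ffunE eqxx mul1n big1 ?addn0// => f /negPf fe.
  by rewrite ffunE fe.
rewrite degree_endpoints [RHS]big_mkcond/=; apply: eq_bigr => z _.
by rewrite ffunE; case: (_ == e); rewrite ?muln1 ?muln0.
Qed.

Lemma sum_edge_deg e : (\sum_x edge_deg e x = 2)%N.
Proof.
have [x xe] : exists x, x \in val e.
  by case: e => E E12 /=; have /andP[+ _] := E12; rewrite card_gt0 => /finset.set0Pn.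
have [y ->] := edge_of_endpoint xe.
under eq_bigr do rewrite edge_deg_of.
rewrite big_split/= (bigD1 x)//= eqxx big1 => [|z /negPf->//].
by rewrite (bigD1 y)//= eqxx big1 => [|z /negPf->].
Qed.

(** A proper edge has two orientations of weight theta_e / 2, a self-edge has one of weight
    theta_e. *)
Lemma sum_dir_weight e :
  \sum_x \sum_(z | edge_of x z == e) dir_weight theta x z = theta e.
Proof.
transitivity (\sum_x theta e * ((edge_deg e x)%:R / 2)).
  apply: eq_bigr => x _; rewrite edge_deg_endpoints natr_sum mulr_suml mulr_sumr.
  by apply: eq_bigr => z /eqP <-; rewrite dir_weightE.
by rewrite -mulr_sumr -mulr_suml -natr_sum sum_edge_deg divff ?mulr1// pnatr_eq0.
Qed.

Definition monomial k : R :=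
  (\prod_e ((k e)`!%:R)^-1) * \prod_e theta e ^+ k e.

Lemma monomial_drop k e : (0 < k e)%N ->
  theta e * monomial (drop_edge k e) = (k e)%:R * monomial k.
Proof.
move=> ke; rewrite /monomial -!big_split/=.
rewrite (bigD1 e)//= [in RHS](bigD1 e)//= !mulrA; congr (_ * _).
  rewrite ffunE eqxx subn1; case: (k e) ke => // m _ /=.
  rewrite exprS factS natrM; field.
  by rewrite !pnatr_eq0 -lt0n fact_gt0 /=; rewrite addrC natr1 pnatr_eq0.
by apply: eq_bigr => f /negPf fe; rewrite ffunE fe subn0.
Qed.

Variable c : {ffun edge A -> nat} -> R.

(* The paths of n steps from x to y, each weighted by c of the current left
   over from k after removing its steps. *)
Fixpoint path_sum n x y k : R :=
  if n is m.+1 then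
    \sum_z if (0 < k (edge_of x z))%N then
             dir_weight theta x z * path_sum m z y (drop_edge k (edge_of x z))
           else 0
  else (x == y)%:R * c k.

(** The function H(x, y; k) of the overview. Each step uses up one unit of [current_size k], so
    longer paths contribute nothing and the truncation is exact. *)
Definition green x y k : R := \sum_(n < (current_size k).+1) path_sum n x y k.

Lemma green_rec x y k : green x y k = (x == y)%:R * c k +
  \sum_z if (0 < k (edge_of x z))%N then
           dir_weight theta x z * green z y (drop_edge k (edge_of x z)) else 0.
Proof.
rewrite /green big_ord_recl /=; congr (_ + _).
rewrite exchange_big/=; apply: eq_bigr => z _.
case: ifPn => [kxz|_]; last by rewrite big1.
by rewrite -mulr_sumr current_size_drop.
Qed.

(** The argument is a degree, that is a doubled local time: at d = 2n, [wSS] is the relation w(n +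
    1) = (n + 1/2) w(n) of the overview. *)
Variable w : nat -> R.
Hypothesis w0 : w 0 = 1.
Hypothesis wSS : forall d, ~~ odd d -> w d.+2 = d.+1%:R / 2 * w d.
Hypothesis c0 : c [ffun=> 0%N] = 1.
Hypothesis c_rec : forall k e, (0 < k e)%N -> (k e)%:R * c k =
  2^-1 * \sum_x \sum_(z | edge_of x z == e)
    dir_weight theta x z * green z x (drop_edge k e).

(** Both formulas go through one strong induction on |k|. The formula for [c k] comes from [green]
    at smaller currents; the one for [green a b k] then uses [c k], when a = b, and [green] at
    smaller currents. *)
Lemma wick_recursion n k : current_size k = n ->
  ((forall x, ~~ odd (degree k x)) ->
     c k = (\prod_x w (degree k x)) * monomial k) /\
  (forall a b, (forall x, ~~ odd (degree k x + (x == a) + (x == b))%N) ->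
     green a b k =
       2 * (\prod_x w (degree k x + (x == a) + (x == b))%N) * monomial k).
Proof.
elim/ltn_ind: n k => n IH k kn.
have {IH}IHgreen e a b : (0 < k e)%N ->
    (forall x, ~~ odd (degree (drop_edge k e) x + (x == a) + (x == b))%N) ->
    green a b (drop_edge k e) =
    2 * (\prod_x w (degree (drop_edge k e) x + (x == a) + (x == b))%N)
      * monomial (drop_edge k e).
  move=> ke; suff /IH/(_ _ erefl)[_] : (current_size (drop_edge k e) < n)%N by apply.
  by rewrite -kn -(current_size_drop ke).
have c_formula : (forall x, ~~ odd (degree k x)) ->
     c k = (\prod_x w (degree k x)) * monomial k.
  move=> kE; have [/existsP[e ke]|] := boolP [exists e, (0 < k e)%N]; last first.
    rewrite negb_exists => /forallP k0.
    have -> : k = [ffun=> 0%N].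
      by apply/ffunP => e; have := k0 e; rewrite ffunE lt0n negbK => /eqP.
    rewrite c0 big1 ?mul1r => [|x _]; last first.
      by rewrite /degree big1 ?w0// => e _; rewrite ffunE.
    by rewrite /monomial !big1 ?mulr1// => e _; rewrite ffunE ?expr0 ?invr1.
  apply: (@mulfI _ (k e)%:R); first by rewrite pnatr_eq0 -lt0n.
  rewrite c_rec//.
  (* The endpoint corrections of [green z x] restore the two ends of e that were dropped, so every
     term carries the same product over the degrees of k. The 2 in the formula for [green] is
     cancelled by t = 1/2. *)
  transitivity (2^-1 * (theta e * (2 * (\prod_x w (degree k x)) *
      monomial (drop_edge k e)))).
    congr (_ * _); rewrite -[in RHS](sum_dir_weight e) mulr_suml.
    apply: eq_bigr => x _; rewrite mulr_suml; apply: eq_bigr => z /eqP xz.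
    have degE y : (degree (drop_edge k e) y + (y == z) + (y == x))%N = degree k y.
      by rewrite -(degree_drop y ke) -xz edge_deg_of addnAC -addnA.
    congr (_ * _); rewrite IHgreen//; last by move=> y; rewrite degE.
    by under eq_bigr do rewrite degE.
  by rewrite [RHS]mulrCA -monomial_drop//; field.
split=> // a b kab; rewrite green_rec.
pose P (d : A -> nat) := \prod_x w (d x).
(* A first step from a to z lowers the degrees at a and z, and the start z of the remaining path
   adds one back at z. The outcome [d] does not depend on z, so the sum over z only produces the
   degree of a. *)
pose d x := (degree k x - (x == a) + (x == b))%N.
have -> : \sum_z (if (0 < k (edge_of a z))%N then
           dir_weight theta a z * green z b (drop_edge k (edge_of a z)) else 0) =
    (degree k a)%:R * P d * monomial k.
  rewrite degree_endpoints natr_sum mulr_suml mulr_suml; apply: eq_bigr => z _.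
  set e := edge_of a z; case: ifPn => [ke|]; last first.
    by rewrite lt0n negbK => /eqP->; rewrite muln0 !mul0r.
  have degE x : (degree (drop_edge k e) x + (x == z) + (x == b))%N = d x.
    by rewrite /d -(degree_drop x ke) edge_deg_of addnCA addKn.
  rewrite IHgreen// => [|x]; last first.
    rewrite degE /d.
    have := kab x; rewrite !oddD oddB; last first.
      by rewrite -(degree_drop x ke) edge_deg_of; lia.
    by rewrite !oddb.
  under eq_bigr do rewrite degE.
  rewrite dir_weightE natrM -/(P d).
  transitivity ((1 + (z == a))%:R * P d * (theta e * monomial (drop_edge k e))).
    by rewrite -/e; field.
  by rewrite monomial_drop// -/e; ring.
rewrite (bigD1 a)//= [P d](bigD1 a)//= /d eqxx.
(* Only the factor at a remains to be compared. If a = b, [c k] and the sum combine to 1 + deg(a) =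
   2 (deg(a) + 1) / 2, which is twice the factor in [wSS]. The truncated subtraction in [d] is
   harmless when deg(a) = 0, as its term is then multiplied by 0. *)
have [ab|ab] := eqVneq a b.
  have kE x : ~~ odd (degree k x).
    by have := kab x; rewrite ab -addnA addnn oddD odd_double addbF.
  rewrite mul1r c_formula//.
  rewrite (bigD1 a)//= {}ab.
  set p := \prod_(_ | _) w (degree k _).
  set p1 := \prod_(_ | _) _; set p2 := \prod_(_ | _) _.
  have -> : p1 = p by apply: eq_bigr => x /negPf->; rewrite subn0 addn0.
  have -> : p2 = p by apply: eq_bigr => x /negPf->; rewrite !addn0.
  rewrite -addnA addn2 wSS// -natr1.
  by case: (degree k b) => [|m]; rewrite /= ?subn1 ?addn1 /=; field.
set p1 := \prod_(_ | _) _; set p2 := \prod_(_ | _) _.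
have -> : p1 = p2 by apply: eq_bigr => x /negPf->; rewrite subn0 addn0.
(* If a and b differ, deg(a) is odd, say m + 1 with m even, and (m + 1) w(m) = 2 w(m + 2). *)
have := kab a; rewrite eqxx (negPf ab) addn0 addn1 /= negbK !addn0.
by case: (degree k a) => // m /= m2; rewrite ?addn1 wSS// subn1 /=; field.
Qed.

End WickRecursion.

(** * Rooted and unrooted loops *)

Lemma sum_tupleS (R : realType) (A : finType) n (F : seq A -> R) :
  \sum_(t : n.+1.-tuple A) F t = \sum_x \sum_(t : n.-tuple A) F (x :: t).
Proof.
rewrite pair_big/= (reindex (fun p : A * n.-tuple A => cons_tuple p.1 p.2))//=.
exists (fun t : n.+1.-tuple A => (thead t, [tuple of behead t])).
  by move=> [x t] _ /=; congr pair; apply/val_inj.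
by move=> t _; rewrite [RHS]tuple_eta; apply/val_inj.
Qed.

Lemma sum_tuple0 (R : realType) (A : finType) (F : seq A -> R) :
  \sum_(t : 0.-tuple A) F t = F [::].
Proof.
rewrite (bigD1 [tuple])//= big1 ?addr0// => t /eqP[].
by rewrite [t]tuple0.
Qed.

Lemma sum_tuple_rot (R : realType) (A : finType) n i (F : seq A -> R) :
  \sum_(t : n.-tuple A) F (rot i t) = \sum_(t : n.-tuple A) F t.
Proof.
rewrite [RHS](reindex (fun t : n.-tuple A => rot_tuple i t))//=.
exists (fun t : n.-tuple A => rotr_tuple i t) => t _; apply/val_inj => /=.
  exact: rotK.
exact: rotrK.
Qed.

Section CyclicSteps.
Variable A : finType.
Implicit Types (r : seq A) (l : loop A).

Definition cyclic_steps r : seq (A * A) := zip r (rot 1 r).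

Lemma size_cyclic_steps r : size (cyclic_steps r) = size r.
Proof. by rewrite size_zip size_rot minnn. Qed.

Lemma cyclic_steps_rot i r : cyclic_steps (rot i r) = rot i (cyclic_steps r).
Proof.
rewrite /cyclic_steps rot_rot; have rs := size_rot 1 r.
rewrite -[RHS]zip_unzip /unzip1 /unzip2 !map_rot.
by rewrite -/(unzip1 _) -/(unzip2 _) unzip1_zip ?unzip2_zip ?rs.
Qed.

Lemma tuple_neq_nil n (t : n.+1.-tuple A) : (t : seq A) != [::].
Proof. by rewrite -size_eq0 size_tuple. Qed.

Definition loop_of_tuple n (t : n.+1.-tuple A) : loop A :=
  (\pi_(loop A) (Sub (val t) (tuple_neq_nil t) : rooted_loop A))%qT.

(** The index n stands for length n + 1, since loops are nontrivial. *)
Definition loops_of_size n : seq (loop A) :=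
  undup [seq loop_of_tuple t | t : n.+1.-tuple A].

Lemma loop_of_tuple_eq n (t : n.+1.-tuple A) l :
  (loop_of_tuple t == l) = (val t \in root_shifts (repr l)).
Proof.
rewrite -[l in LHS]reprK /loop_of_tuple eq_sym.
by rewrite eqmodE.
Qed.

Lemma size_root_shift l r : r \in root_shifts (repr l) -> size r = loop_length l.
Proof. by move=> /mapP[i _ ->]; rewrite size_rot. Qed.

Lemma mem_loops_of_size n l : (l \in loops_of_size n) = (loop_length l == n.+1).
Proof.
rewrite mem_undup; apply/mapP/eqP => [[t _ tl]|ln].
  rewrite -(@size_root_shift l t) ?size_tuple//.
  by rewrite -loop_of_tuple_eq -tl.
exists (Tuple (introT eqP ln)); first by rewrite mem_enum.
apply/esym/eqP; rewrite loop_of_tuple_eq /=.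
apply/mapP; exists 0%N; rewrite ?rot0// mem_iota/= add0n.
by rewrite -/(loop_length l) ln.
Qed.

(** Rooted loops are grouped by their class: l has [loop_reps l] distinct rootings, on which F is
    constant. *)
Lemma sum_loops_of_size (R : realType) n (F : seq A -> R) :
  (forall i r, F (rot i r) = F r) ->
  \sum_(t : n.+1.-tuple A) F t =
  \sum_(l <- loops_of_size n) (loop_reps l)%:R * F (val (repr l)).
Proof.
move=> Frot.
transitivity (\sum_(t : n.+1.-tuple A)
    \sum_(l <- loops_of_size n | loop_of_tuple t == l) F t).
  apply: eq_bigr => t _; rewrite -big_filter.
  rewrite (@eq_filter _ _ (pred1 (loop_of_tuple t))) => [|l]; last by rewrite /= eq_sym.
  rewrite filter_pred1_uniq ?undup_uniq ?big_seq1// mem_undup.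
  by apply/mapP; exists t; rewrite ?mem_enum.
rewrite (exchange_big_dep predT)//= big_seq [RHS]big_seq; apply: eq_bigr => l.
rewrite mem_loops_of_size => /eqP ln.
transitivity (\sum_(t : n.+1.-tuple A | loop_of_tuple t == l) F (val (repr l))).
  apply: eq_bigr => t; rewrite loop_of_tuple_eq => /mapP[i _ ->].
  exact: Frot.
rewrite sumr_const mulr_natl; congr (_ *+ _).
rewrite (@eq_card _ _ [pred t : n.+1.-tuple A | val t \in root_shifts (repr l)]);
  last by move=> t; exact: loop_of_tuple_eq.
rewrite /loop_reps cardE -(size_map (@tval _ _)).
apply/perm_size/uniq_perm; rewrite ?undup_uniq//.
  by rewrite map_inj_uniq ?enum_uniq//; exact: val_inj.
move=> r; rewrite mem_undup; apply/mapP/idP => [[t]|rl].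
  by rewrite mem_enum inE => + ->.
have rn : size r == n.+1 by rewrite (size_root_shift rl) ln.
by exists (Tuple rn); rewrite // mem_enum inE.
Qed.

End CyclicSteps.

Arguments loops_of_size : clear implicits.

(** * Powers of the weight matrix, path sums and loop sums *)

Section LoopSums.
Variables (R : realType) (A : finType) (theta : edge A -> R).
Implicit Types (k : {ffun edge A -> nat}) (e : edge A) (x y z : A) (s : seq (A * A)).

Definition path_weight s : R := \prod_(p <- s) dir_weight theta p.1 p.2.

Definition steps_current s : {ffun edge A -> nat} :=
  [ffun e => count (fun p => edge_of p.1 p.2 == e) s].

Lemma weight_mx_exp n x y :
  (weight_mx theta ^+ n.+1) (enum_rank x) (enum_rank y) =
  \sum_(t : n.-tuple A) path_weight (zip (x :: t) (rcons t y)).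
Proof.
elim: n x => [|n IH] x.
  rewrite (sum_tuple0 (fun t => path_weight (zip (x :: t) (rcons t y)))) /=.
  by rewrite /path_weight big_seq1 expr1 mxE !enum_rankK.
rewrite (sum_tupleS _ (fun t => path_weight (zip (x :: t) (rcons t y)))) /=.
rewrite exprS [LHS]mxE (reindex (@enum_rank A)); last first.
  by exists enum_val => i _; rewrite ?enum_rankK ?enum_valK.
apply: eq_bigr => z _; rewrite IH mxE !enum_rankK mulr_sumr.
by apply: eq_bigr => t _; rewrite /path_weight big_cons.
Qed.

Lemma trace_weight_mx n : \tr (weight_mx theta ^+ n.+1) =
  \sum_(t : n.+1.-tuple A) path_weight (cyclic_steps t).
Proof.
rewrite (sum_tupleS _ (fun t => path_weight (cyclic_steps t))) /mxtrace.
rewrite (reindex (@enum_rank A)); last first.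
  by exists enum_val => i _; rewrite ?enum_rankK ?enum_valK.
apply: eq_bigr => x _; rewrite weight_mx_exp; apply: eq_bigr => t _.
by rewrite /cyclic_steps rot1_cons.
Qed.

Lemma path_weight_rot i s : path_weight (rot i s) = path_weight s.
Proof. by apply: perm_big; rewrite perm_rot. Qed.

Lemma steps_current_rot i s : steps_current (rot i s) = steps_current s.
Proof. by apply/ffunP => e; rewrite !ffunE; apply/permP; rewrite perm_rot. Qed.

Lemma loop_reps_measure n l : l \in loops_of_size A n ->
  loop_measure theta l =
  n.+1%:R^-1 * ((loop_reps l)%:R * path_weight (cyclic_steps (val (repr l)))).
Proof. by rewrite mem_loops_of_size mulrC /loop_measure => /eqP ->. Qed.

Lemma sum_loop_measure n :
  \sum_(l <- loops_of_size A n) loop_measure theta l =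
  \tr (weight_mx theta ^+ n.+1) / n.+1%:R.
Proof.
rewrite trace_weight_mx (@sum_loops_of_size _ _ _ (path_weight \o @cyclic_steps A)).
  rewrite mulrC mulr_sumr big_seq [RHS]big_seq; apply: eq_bigr => l.
  exact: loop_reps_measure.
by move=> i r /=; rewrite cyclic_steps_rot path_weight_rot.
Qed.

Variable c : {ffun edge A -> nat} -> R.

(** The contribution of a single path to [path_sum]. Steps are removed one by one, but by [spendE]
    their order is irrelevant, whence invariance under rotation. *)
Fixpoint spend k s : R :=
  if s is p :: s' then
    if (0 < k (edge_of p.1 p.2))%N then
      dir_weight theta p.1 p.2 * spend (drop_edge k (edge_of p.1 p.2)) s'
    else 0
  else c k.

Lemma spendE k s : spend k s =
  if [forall e, (steps_current s e <= k e)%N] then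
    path_weight s * c [ffun e => (k e - steps_current s e)%N]
  else 0.
Proof.
rewrite /path_weight; elim: s k => [|p s IH] k /=.
  rewrite big_nil mul1r ifT; last by apply/forallP => e; rewrite ffunE.
  by congr c; apply/ffunP => e; rewrite !ffunE subn0.
rewrite big_cons IH; set e0 := edge_of _ _.
have stepsE e : steps_current (p :: s) e = ((e == e0) + steps_current s e)%N.
  by rewrite !ffunE /= eq_sym.
case: ifPn => [k0|]; last first.
  rewrite -leqNgt leqn0 => /eqP k0; rewrite ifF//; apply/negbTE/forallPn.
  by exists e0; rewrite stepsE k0 eqxx.
have -> : [forall e, (steps_current s e <= drop_edge k e0 e)%N] =
          [forall e, (steps_current (p :: s) e <= k e)%N].
  apply: eq_forallb => e; rewrite stepsE -(drop_edgeK e k0) addnC.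
  by rewrite leq_add2r.
case: ifP => _; last by rewrite mulr0.
rewrite mulrA; congr (_ * c _); apply/ffunP => e.
by rewrite !ffunE -subnDA /= [e0 == e]eq_sym.
Qed.

Lemma spend_rot k i s : spend k (rot i s) = spend k s.
Proof. by rewrite !spendE path_weight_rot steps_current_rot. Qed.

Lemma path_sumE n x y k : path_sum theta c n.+1 x y k =
  \sum_(t : n.-tuple A) spend k (zip (x :: t) (rcons t y)).
Proof.
elim: n x k => [|n IH] x k.
  rewrite (sum_tuple0 (fun t => spend k (zip (x :: t) (rcons t y)))) /=.
  rewrite (bigD1 y)//= eqxx mul1r big1 ?addr0// => z /negPf ->.
  by rewrite mul0r mulr0 if_same.
rewrite (sum_tupleS _ (fun t => spend k (zip (x :: t) (rcons t y)))) /=.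
apply: eq_bigr => z _; case: ifPn => _; last by rewrite big1.
by rewrite -mulr_sumr -IH.
Qed.

(** A rooted loop whose first step traverses e is an orientation x, z of e followed by a path of n
    steps from z back to x. The loop has n + 1 steps, so the default of [head] is never taken. *)
Lemma sum_spend_first_step n k e :
  \sum_(t : n.+1.-tuple A)
    (if head e [seq edge_of p.1 p.2 | p <- cyclic_steps t] == e
     then spend k (cyclic_steps t) else 0) =
  \sum_x \sum_(z | edge_of x z == e) if (0 < k e)%N then
    dir_weight theta x z * path_sum theta c n z x (drop_edge k e) else 0.
Proof.
pose F t := if head e [seq edge_of p.1 p.2 | p <- cyclic_steps t] == e
     then spend k (cyclic_steps t) else 0.
rewrite (sum_tupleS _ F); apply: eq_bigr => x _.
rewrite [RHS]big_mkcond; case: n => [|n].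
  (* The return path is empty here, which forces z = x and a self-edge. *)
  rewrite (sum_tuple0 (fun t => F (x :: t))) (bigD1 x)//= [X in _ + X]big1 ?addr0.
    rewrite /F /cyclic_steps /= eqxx mul1r.
    by case: eqP => [->|_].
  move=> z /negPf ->.
  by rewrite mul0r mulr0 !if_same.
rewrite (sum_tupleS _ (fun t => F (x :: t))); apply: eq_bigr => z _.
under eq_bigr do rewrite /F /cyclic_steps rot1_cons /=.
case: eqP => [->|_]; last by rewrite big1.
case: ifPn => _; last by rewrite big1.
by rewrite -mulr_sumr -path_sumE.
Qed.

(* Rotating a rooted loop moves any of its n + 1 steps to the front, which
   cancels the factor 1 / |l| of the loop measure. *)
Lemma sum_loops_spend n k e :
  \sum_(l <- loops_of_size A n)
    (traversals l e)%:R * (loop_measure theta l *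
      if [forall f, (traversals l f <= k f)%N] then
        c [ffun f => (k f - traversals l f)%N] else 0) =
  \sum_x \sum_(z | edge_of x z == e) if (0 < k e)%N then
    dir_weight theta x z * path_sum theta c n z x (drop_edge k e) else 0.
Proof.
pose F r := (steps_current (cyclic_steps r) e)%:R * spend k (cyclic_steps r).
have Frot i r : F (rot i r) = F r.
  by rewrite /F cyclic_steps_rot steps_current_rot spend_rot.
transitivity (n.+1%:R^-1 * \sum_(t : n.+1.-tuple A) F t).
  rewrite (@sum_loops_of_size _ _ _ (F))// mulr_sumr big_seq [RHS]big_seq.
  apply: eq_bigr => l ln; rewrite (loop_reps_measure ln) /F spendE.
  set st := steps_current _.
  have stE f : st f = traversals l f by rewrite ffunE.
  have -> : [forall f, (st f <= k f)%N] = [forall f, (traversals l f <= k f)%N].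
    by apply: eq_forallb => f; rewrite stE.
  have -> : [ffun f => (k f - st f)%N] = [ffun f => (k f - traversals l f)%N].
    by apply/ffunP => f; rewrite !ffunE.
  by rewrite stE; case: ifP => _; [ring|rewrite !mulr0].
rewrite -sum_spend_first_step.
set G := fun t : seq A => if head e [seq edge_of p.1 p.2 | p <- cyclic_steps t] == e
     then spend k (cyclic_steps t) else 0.
suff -> : \sum_(t : n.+1.-tuple A) F t = n.+1%:R * \sum_(t : n.+1.-tuple A) G t.
  by rewrite mulKf// pnatr_eq0.
transitivity (\sum_(i < n.+1) \sum_(t : n.+1.-tuple A) G (rot i t)).
  rewrite exchange_big/=; apply: eq_bigr => t _.
  have sz : size (cyclic_steps t) = n.+1 by rewrite size_cyclic_steps size_tuple.
  rewrite /F ffunE -sum1_count (big_nth (head (thead t, thead t) (cyclic_steps t))) sz.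
  rewrite big_mkord natr_sum mulr_suml big_mkcond/=; apply: eq_bigr => i _.
  rewrite /G cyclic_steps_rot spend_rot mul1r map_rot.
  have -> : head e (rot i [seq edge_of p.1 p.2 | p <- cyclic_steps t]) =
    nth e [seq edge_of p.1 p.2 | p <- cyclic_steps t] i.
    by rewrite -nth0 /rot nth_cat size_drop size_map sz subn_gt0 ltn_ord nth_drop addn0.
  by rewrite (nth_map (head (thead t, thead t) (cyclic_steps t))) ?sz.
under eq_bigr do rewrite sum_tuple_rot.
by rewrite sumr_const card_ord mulr_natl.
Qed.

End LoopSums.

(** * Multisets of loops *)

Lemma expr_div_fact (R : realType) (x : R) n :
  n.+1%:R * (x ^+ n.+1 / n.+1`!%:R) = x * (x ^+ n / n`!%:R).
Proof.
rewrite factS natrM exprS invfM -!mulrA mulrCA; congr (_ * _).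
by rewrite mulrCA mulVKf// pnatr_eq0.
Qed.

Section SoupCurrents.
Variables (R : realType) (A : finType) (theta : edge A -> R) (t : R).
Implicit Types (k : {ffun edge A -> nat}) (e : edge A) (l : loop A) (N : {mset loop A}).

Definition soup_weight N : R :=
  \prod_(l <- finsupp N) ((t * loop_measure theta l) ^+ N l / (N l)`!%:R).

Lemma soup_weight_sub (S : {fset loop A}) N : (finsupp N `<=` S)%fset ->
  soup_weight N = \prod_(l <- S) ((t * loop_measure theta l) ^+ N l / (N l)`!%:R).
Proof.
move=> NS; apply: big_fset_incl => // l _ lN; rewrite fsfun_dflt//.
by rewrite expr0 fact0 divr1.
Qed.

(** The Poisson identity (n + 1) x^(n+1) / (n+1)! = x x^n / n! at the factor of l; the other factors
    agree once both products run over a common support. *)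
Lemma soup_weightD l N : (N l).+1%:R * soup_weight (l +` N) =
  t * loop_measure theta l * soup_weight N.
Proof.
have lS : l \in finsupp (l +` N) by rewrite msuppE mset1D1.
rewrite (@soup_weight_sub (finsupp (l +` N)) N); last first.
  by apply/fsubsetP => l'; rewrite !msuppE => /mset1Dr; exact.
rewrite /soup_weight !(big_fsetD1 l lS)/= mset1DE eqxx add1n.
rewrite !mulrA -[X in X * _ = _]mulrA expr_div_fact !mulrA; congr (_ * _).
apply: eq_big_seq => l'; rewrite in_fsetD1 => /andP[/negPf l'l _].
by rewrite mset1DE l'l.
Qed.

Lemma sum_traversals l : (\sum_e traversals l e)%N = loop_length l.
Proof.
rewrite /traversals; under eq_bigr do rewrite -sum1_count.
rewrite (exchange_big_dep predT)//= (eq_bigr (fun=> 1%N)).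
  by rewrite sum1_size /loop_length -(size_cyclic_steps (val (repr l))).
by move=> p _; rewrite (big_pred1 (edge_of p.1 p.2))// => e; rewrite eq_sym.
Qed.

Lemma soup_current_sub (S : {fset loop A}) N e : (finsupp N `<=` S)%fset ->
  soup_current N e = (\sum_(l <- S) N l * traversals l e)%N.
Proof.
move=> NS; rewrite ffunE; apply: big_fset_incl => // l _ lN; by rewrite fsfun_dflt.
Qed.

Lemma soup_current0 : soup_current mset0 = [ffun=> 0%N] :> {ffun edge A -> nat}.
Proof. by apply/ffunP => e; rewrite !ffunE finsupp0 big_seq_fset0. Qed.

Lemma soup_currentD l N e :
  soup_current (l +` N) e = (traversals l e + soup_current N e)%N.
Proof.
have lS : l \in finsupp (l +` N) by rewrite msuppE mset1D1.
rewrite (@soup_current_sub (finsupp (l +` N)) N); last first.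
  by apply/fsubsetP => l'; rewrite !msuppE => /mset1Dr; exact.
rewrite ffunE !(big_fsetD1 l lS)/= mset1DE eqxx mulnDl mul1n -addnA.
congr (_ + (_ + _))%N.
apply: eq_big_seq => l'; rewrite in_fsetD1 => /andP[/negPf l'l _].
by rewrite mset1DE l'l.
Qed.

Lemma traversals_le l N e : l \in N -> (traversals l e <= soup_current N e)%N.
Proof. by move=> /msetB1K <-; rewrite soup_currentD leq_addr. Qed.

Lemma loop_length_gt0 l : (0 < loop_length l)%N.
Proof. by rewrite lt0n size_eq0; exact: (valP (repr l)). Qed.

Lemma loop_length_le l N k : l \in N -> soup_current N = k ->
  (loop_length l <= current_size k)%N.
Proof.
move=> lN <-; rewrite -sum_traversals /current_size; apply: leq_sum => e _.
exact: traversals_le.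
Qed.

Definition msets_of_current k : set {mset loop A} := @soup_current A @^-1` [set k].

Definition current_diff k l : {ffun edge A -> nat} :=
  [ffun e => (k e - traversals l e)%N].

Lemma current_size_diff k l : (forall e, traversals l e <= k e)%N ->
  (current_size (current_diff k l) < current_size k)%N.
Proof.
move=> lk; have -> : current_size k = (current_size (current_diff k l) + loop_length l)%N.
  rewrite -sum_traversals -big_split; apply: eq_bigr => e _.
  by rewrite ffunE /= subnK.
by rewrite -addn1 leq_add2l loop_length_gt0.
Qed.

Lemma msets_of_currentD k l N : (forall e, traversals l e <= k e)%N ->
  msets_of_current k (l +` N) <-> msets_of_current (current_diff k l) N.
Proof.
move=> lk; split=> /ffunP E; apply/ffunP => e; have := E e.
  by rewrite soup_currentD => kE; rewrite [RHS]ffunE -kE addKn.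
by move=> kE; rewrite soup_currentD kE [current_diff _ _ _]ffunE subnKC.
Qed.

Lemma msets_of_current_le k l N e : msets_of_current k N -> l \in N ->
  (traversals l e <= k e)%N.
Proof. by move=> <-; exact: traversals_le. Qed.

(** Induction on |k|: a nonempty multiset of current k is a loop l fitting into k, of length at most
    |k|, plus a multiset of the strictly smaller current k - l. *)
Lemma finite_msets_of_current k : finite_set (msets_of_current k).
Proof.
have [n] := ubnP (current_size k); elim: n k => // n IH k kn.
pose U := ([set` [fset l in
    flatten [seq loops_of_size A i | i <- iota 0 (current_size k)]]%fset]
  `&` [set l | forall e, (traversals l e <= k e)%N])%classic.
apply: (@sub_finite_set _ _ ([set mset0] `|`
    \bigcup_(l in U) ((fun N => l +` N) @` msets_of_current (current_diff k l)))%classic).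
  move=> N kN; have [->|[l lN]] := mset_0Vmem N; first by left.
  have lk e : (traversals l e <= k e)%N by exact: msets_of_current_le kN lN.
  right; exists l.
    split => //=; rewrite !inE; apply/flattenP.
    exists (loops_of_size A (loop_length l).-1).
      apply/mapP; exists (loop_length l).-1 => //.
      rewrite mem_iota /= add0n prednK ?loop_length_gt0//.
      exact: loop_length_le kN.
    by rewrite mem_loops_of_size prednK ?loop_length_gt0.
  exists (N `\ l); last exact: msetB1K.
  by apply/(msets_of_currentD _ lk); rewrite msetB1K.
rewrite finite_setU; split; first exact: finite_set1.
apply: bigcup_finite; first exact/finite_setIl/finite_fset.
move=> l [_ lk]; apply/finite_image/IH.
by rewrite (leq_trans (current_size_diff lk)).
Qed.

(** The function c(k) of the overview. *)
Definition current_weight k : R :=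
  \sum_(N <- fset_set (msets_of_current k)) soup_weight N.

Lemma mem_msets_of_current k N :
  (N \in fset_set (msets_of_current k)) = (soup_current N == k).
Proof.
rewrite in_fset_set; last exact: finite_msets_of_current.
by apply/idP/eqP => [/set_mem|/mem_set].
Qed.

Lemma current_weight0 : current_weight [ffun=> 0%N] = 1.
Proof.
rewrite /current_weight (big_fsetD1 mset0) ?mem_msets_of_current ?soup_current0//=.
rewrite /soup_weight finsupp0 big_seq_fset0 big_seq big1 ?addr0// => N.
rewrite in_fsetD1 mem_msets_of_current => /andP[N0 /eqP kN].
have [/eqP|[l lN]] := mset_0Vmem N; first by rewrite (negPf N0).
have size0 : current_size ([ffun=> 0%N] : {ffun edge A -> nat}) = 0%N.
  by rewrite /current_size big1// => e _; rewrite ffunE.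
by have := loop_length_le lN kN; rewrite size0 leqNgt loop_length_gt0.
Qed.

Lemma sum_soup_weight_mult k l :
  \sum_(N <- fset_set (msets_of_current k)) (N l)%:R * soup_weight N =
  t * loop_measure theta l *
    if [forall e, (traversals l e <= k e)%N] then current_weight (current_diff k l)
    else 0.
Proof.
case: ifPn => [/forallP lk|]; last first.
  move=> /forallPn[e lk]; rewrite mulr0 big_seq big1// => N.
  rewrite mem_msets_of_current => /eqP kN; have [->|lN] := eqVneq (N l) 0%N.
    by rewrite mul0r.
  by rewrite (@msets_of_current_le k l N) -?mset_neq0// in lk.
rewrite (bigID (fun N => l \in N))/= [X in _ + X]big1 ?addr0; last first.
  by move=> N /mset_eq0P ->; rewrite mul0r.
rewrite mulr_sumr; under [RHS]eq_bigr do rewrite -soup_weightD.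
rewrite -big_filter.
transitivity (\sum_(N <- [seq l +` N |
    N <- fset_set (msets_of_current (current_diff k l))])
   (N l)%:R * soup_weight N); last first.
  by rewrite big_map; apply: eq_bigr => N _; rewrite mset1DE eqxx add1n.
apply/perm_big/uniq_perm; first exact/filter_uniq/fset_uniq.
  by rewrite map_inj_uniq ?fset_uniq//; exact: (can_inj (msetDKB _)).
move=> N; rewrite mem_filter mem_msets_of_current; apply/andP/mapP => [[lN kN]|].
  exists (N `\ l); last by rewrite msetB1K.
  rewrite mem_msets_of_current; apply/eqP/(msets_of_currentD _ lk).
  by rewrite msetB1K//; exact/eqP.
move=> [N' + ->]; rewrite mem_msets_of_current mset1D1 => /eqP kN'; split=> //.
exact/eqP/(msets_of_currentD _ lk).
Qed.

(** Replaces the support of N by index sets independent of N, so that sums over multisets and over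
    loops can be exchanged. *)
Lemma soup_current_graded n N e : (forall l, l \in N -> loop_length l <= n)%N ->
  soup_current N e = (\sum_(i < n) \sum_(l <- loops_of_size A i) N l * traversals l e)%N.
Proof.
move=> Nn.
transitivity (\sum_(i < n) \sum_(l <- finsupp N | loop_length l == i.+1)
    N l * traversals l e)%N.
  rewrite (exchange_big_dep predT)//= ffunE big_seq [RHS]big_seq; apply: eq_bigr => l.
  rewrite msuppE => lN; have := Nn _ lN; have := loop_length_gt0 l.
  case: (loop_length l) => // m _ mn.
  by rewrite (big_pred1 (Ordinal mn))// => i; rewrite eqSS eq_sym.
apply: eq_bigr => i _; rewrite [RHS](bigID (fun l => l \in N))/=.
rewrite [X in (_ + X)%N]big1 ?addn0.
  rewrite -big_filter -[RHS]big_filter; apply/perm_big/uniq_perm.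
  - exact/filter_uniq/fset_uniq.
  - exact/filter_uniq/undup_uniq.
  by move=> l; rewrite !mem_filter mem_loops_of_size msuppE andbC.
by move=> l /mset_eq0P ->; rewrite mul0n.
Qed.

(** Here k_e is written as the number of traversals of e by the loops of N; each loop l is then
    removed from N and rooted at its traversals of e. *)
Lemma current_weight_rec k e : (0 < k e)%N -> (k e)%:R * current_weight k =
  t * \sum_x \sum_(z | edge_of x z == e)
    dir_weight theta x z * green theta current_weight z x (drop_edge k e).
Proof.
move=> ke.
transitivity (\sum_(i < current_size k) \sum_(l <- loops_of_size A i)
    (traversals l e)%:R *
      \sum_(N <- fset_set (msets_of_current k)) (N l)%:R * soup_weight N).
  under [RHS]eq_bigr => i _.
    under eq_bigr do rewrite mulr_sumr.
    rewrite exchange_big; over.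
  rewrite exchange_big/= mulr_sumr big_seq [RHS]big_seq; apply: eq_bigr => N.
  rewrite mem_msets_of_current => /eqP kN.
  rewrite -[in LHS]kN (@soup_current_graded (current_size k)); last first.
    by move=> l lN; exact: loop_length_le kN.
  rewrite natr_sum mulr_suml; apply: eq_bigr => i _.
  rewrite natr_sum mulr_suml; apply: eq_bigr => l _.
  by rewrite natrM mulrAC mulrC.
transitivity (t * \sum_(i < current_size k) \sum_(l <- loops_of_size A i)
    (traversals l e)%:R * (loop_measure theta l *
      if [forall f, (traversals l f <= k f)%N] then
        current_weight [ffun f => (k f - traversals l f)%N] else 0)).
  rewrite mulr_sumr; apply: eq_bigr => i _; rewrite mulr_sumr; apply: eq_bigr => l _.
  by rewrite sum_soup_weight_mult -/(current_diff k l); ring.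
(* A loop of i + 1 steps leaves a return path of i steps, and i < |k| = |k - e| + 1 is the range of
   the sum in [green]. *)
congr (_ * _); under eq_bigr do rewrite sum_loops_spend ke.
rewrite exchange_big/=; apply: eq_bigr => x _.
rewrite exchange_big/=; apply: eq_bigr => z _.
by rewrite -mulr_sumr /green current_size_drop.
Qed.

End SoupCurrents.

(** * Traces and determinants of symmetric matrices *)

Section SymmetricTrace.
Variables (R : realType) (n : nat).
Implicit Types M : 'M[R]_n.

Local Notation toC := (real_complex R).

(** The complexified matrix is hermitian, hence diagonalizable with real eigenvalues. Trace and
    determinant are computed over the complex numbers and brought back by injectivity of the
    embedding. *)
Lemma symmetric_spectrum M : M^T = M -> exists d : 'I_n -> R,
  [/\ forall m, \tr (M ^+ m) = \sum_i d i ^+ m,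
      \det (1%:M - M) = \prod_i (1 - d i) &
      forall i, eigenvalue (map_mx toC M) (toC (d i))].
Proof.
move=> Msym; pose C := map_mx toC M.
have Cherm : C \is hermsymmx.
  apply: realsym_hermsym.
    by apply/is_hermitianmxP; rewrite expr0 scale1r map_mx_id// matrix.map_trmx Msym.
  by apply/mxOverP => i j; rewrite mxE complex_real.
have := hermitian_spectral_diag_real Cherm.
have /hermitian_normalmx/orthomx_spectralP := Cherm.
have := spectral_unit C.
set P := spectralmx C; set D := spectral_diag C => PU CE /mxOverP Dreal.
pose d i := complex.Re (D 0 i).
have dE i : D 0 i = toC (d i).
  by rewrite [RHS]RRe_real.
have DX m : diag_mx D ^+ m = diag_mx (\row_i (D 0 i) ^+ m).
  elim: m => [|m IH]; first by apply/matrixP => i j; rewrite !mxE expr0.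
  rewrite exprS IH -[_ * _]/(_ *m _) mulmx_diag; apply/matrixP => i j; rewrite !mxE exprS.
  by case: eqP => // ->.
have CX m : C ^+ m = invmx P *m diag_mx D ^+ m *m P.
  elim: m => [|m IH]; first by rewrite !expr0 mulmx1 mulVmx.
  rewrite exprS IH -[LHS]/(C *m (invmx P *m diag_mx D ^+ m *m P)) {1}CE.
  have -> : diag_mx D ^+ m.+1 = diag_mx D *m diag_mx D ^+ m by exact: exprS.
  by rewrite !mulmxA mulmxK.
exists d; split.
- move=> m; apply: (@complexI R).
  rewrite -trace_map_mx rmorphXn /= -/C CX mxtrace_mulC mulmxA mulmxV// mul1mx.
  rewrite DX mxtrace_diag rmorph_sum/=; apply: eq_bigr => i _.
  by rewrite mxE dE rmorphXn.
- apply: (@complexI R); rewrite -det_map_mx map_mxB map_mx1 -/C.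
  have -> : 1%:M - C = invmx P *m (1%:M - diag_mx D) *m P.
    by rewrite mulmxBr mulmx1 mulmxBl -CE mulVmx.
  rewrite !det_mulmx mulrAC -det_mulmx mulVmx// det1 mul1r.
  have -> : 1%:M - diag_mx D = diag_mx (\row_i (1 - D 0 i)).
    apply/matrixP => i j; rewrite !mxE; case: eqP => _; rewrite ?mulr1n ?mulr0n ?subr0//.
  rewrite det_diag rmorph_prod/=; apply: eq_bigr => i _.
  by rewrite mxE dE rmorphB rmorph1.
(* The eigenvector for d_i is row i of P. *)
- move=> i; apply/eigenvalueP; exists (delta_mx 0 i *m P).
    rewrite -/C {1}CE !mulmxA mulmxK// -dE scalemxAl; congr (_ *m _).
    apply/rowP => j; rewrite -rowE !mxE /= [j == i]eq_sym.
    by have [->|_] := eqVneq i j; rewrite ?mulr1 ?mulr0.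
  rewrite -(mul0mx _ P) (inj_eq (can_inj (mulmxK PU))).
  apply/eqP => /rowP/(_ i); rewrite !mxE !eqxx /=; exact/eqP/oner_neq0.
Qed.
End SymmetricTrace.

(** * The logarithm series and the determinant *)

Section LogDet.
Variable R : realType.

Lemma is_derive_log_partial_sum N (y : R) :
  is_derive y 1 (fun y : R => \sum_(i < N) y ^+ i.+1 / i.+1%:R) (\sum_(i < N) y ^+ i).
Proof.
elim: N => [|N IH].
  under eq_fun do rewrite big_ord0.
  by rewrite big_ord0; exact: is_derive_cst.
under eq_fun do rewrite big_ord_recr/=.
rewrite big_ord_recr/=; apply: is_deriveD => //.
have -> : (fun y : R => y ^+ N.+1 / N.+1%:R) = N.+1%:R^-1 \*: ((@id R) ^+ N.+1).
  by apply/funext => z; rewrite /= mulrC exprfctE.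
apply: is_derive_eq.
by rewrite /GRing.scale/= mulr1 mulrA mulVf ?mul1r// pnatr_eq0.
Qed.

(** The left side inside the norm vanishes at 0 and has derivative -1/(1-y) + (1-y^N)/(1-y) =
    -y^N/(1-y); the mean value theorem between 0 and x gives the bound. *)
Lemma log_partial_sum_error N (x : R) : `|x| < 1 ->
  `|ln (1 - x) + \sum_(i < N) x ^+ i.+1 / i.+1%:R| <= `|x| / (1 - `|x|) * `|x| ^+ N.
Proof.
move=> x1; pose h (y : R) := ln (1 - y) + \sum_(i < N) y ^+ i.+1 / i.+1%:R.
have dh (y : R) : `|y| < 1 -> is_derive y 1 h (- (y ^+ N / (1 - y))).
  move=> y1; have y1' : 0 < 1 - y by rewrite subr_gt0 (le_lt_trans (ler_norm _)).
  have dln : is_derive y 1 (fun y => ln (1 - y)) (- (1 - y)^-1).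
    have := is_derive1_ln y1' => dl.
    have d1 : is_derive y 1 (fun y : R => 1 - y) (-1).
      by apply: is_derive_eq; rewrite add0r mul1r.
    by rewrite -mulrN1; exact: (@is_derive1_comp _ (@ln R)).
  have -> : - (y ^+ N / (1 - y)) = - (1 - y)^-1 + \sum_(i < N) y ^+ i.
    apply: (@mulfI _ (1 - y)); first by rewrite gt_eqF.
    rewrite mulrDr !mulrN mulfV ?gt_eqF// mulrCA mulfV ?gt_eqF// mulr1.
    by rewrite -[X in X * \sum_(i < _) _]opprB mulNr -subrX1; ring.
  apply: is_deriveD => //; exact: is_derive_log_partial_sum.
have h0 : h 0 = 0.
  by rewrite /h subr0 ln1 add0r big1// => i _; rewrite expr0n mul0r.
have mvt a b : a <= b -> (forall y, a <= y <= b -> `|y| <= `|x|) ->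
    exists2 c : R, `|c| <= `|x| & h b - h a = - (c ^+ N / (1 - c)) * (b - a).
  move=> ab abx; have dab y : y \in `[a, b] -> is_derive y 1 h (- (y ^+ N / (1 - y))).
    by rewrite in_itv /= => /abx yx; apply/dh/(le_lt_trans yx).
  have dabo y : y \in `]a, b[ -> is_derive y 1 h (- (y ^+ N / (1 - y))).
    by move=> yab; apply: dab; exact: subset_itv_oo_cc.
  have ch : {within `[a, b], continuous h}.
    by apply: derivable_within_continuous => y /dab [].
  have [c cab ->] := MVT_segment ab dabo ch.
  by exists c => //; apply: abx; rewrite in_itv in cab.
have [c cx hx] : exists2 c : R, `|c| <= `|x| & h x = - (c ^+ N / (1 - c)) * x.
  have [x0|x0] := leP 0 x.
    have [|c cx E] := mvt 0 x x0.
      by move=> y /andP[y0 yx]; rewrite !ger0_norm.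
    by exists c => //; rewrite -[h x]subr0 -h0 E subr0.
  have [|c cx E] := mvt x 0 (ltW x0).
    by move=> y /andP[y0 yx]; rewrite !ler0_norm ?lerN2// ltW.
  by exists c => //; move: E; rewrite h0 !sub0r mulrN => /oppr_inj ->.
have c1 : `|c| < 1 := le_lt_trans cx x1.
have c1' : 0 < 1 - c by rewrite subr_gt0 (le_lt_trans (ler_norm _)).
rewrite -/(h x) hx normrM normrN mulrC -mulrA ler_wpM2l//.
rewrite normrM normfV normrX (gtr0_norm c1') mulrC.
rewrite ler_pM ?exprn_ge0 ?invr_ge0 ?(ltW c1')//.
  have x1' : 0 < 1 - `|x| by rewrite subr_gt0.
  by rewrite lef_pV2 ?posrE// lerD2l lerN2 (le_trans (ler_norm _)).
by rewrite lerXn2r ?nnegrE.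
Qed.

Lemma cvg_log_series (x : R) : `|x| < 1 ->
  \sum_(i < n) x ^+ i.+1 / i.+1%:R @[n --> \oo] --> - ln (1 - x).
Proof.
move=> x1; apply/cvgrPdist_lt => e e0.
have := @cvg_geometric R (`|x| / (1 - `|x|)) `|x|.
rewrite normr_id => /(_ x1)/cvgrPdist_lt/(_ _ e0); apply: filterS => n.
rewrite sub0r normrN => /(le_lt_trans (ler_norm _)); apply: le_lt_trans.
by rewrite -normrN opprB opprK addrC; exact: log_partial_sum_error.
Qed.

Lemma sqrt_prod_log (I : finType) (d : I -> R) : (forall i, `|d i| < 1) ->
  Num.sqrt (\prod_i (1 - d i)) = expR (- (2^-1 * \sum_i - ln (1 - d i))).
Proof.
move=> d1; rewrite sumrN mulrN opprK.
have d1' i : 0 < 1 - d i by rewrite subr_gt0 (le_lt_trans (ler_norm _)).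
have -> : \prod_i (1 - d i) = expR (2^-1 * \sum_i ln (1 - d i)) ^+ 2.
  rewrite -expRM_natl mulrA divff ?pnatr_eq0// mul1r expR_sum.
  by apply: eq_bigr => i _; rewrite lnK ?posrE.
by rewrite sqrtr_sqr gtr0_norm// expR_gt0.
Qed.


(* The bound on the even powers forces every eigenvalue into ]-1, 1[. *)
Lemma sqrt_det_trace_series n (M : 'M[R]_n) (rho : R) : M^T = M ->
  0 <= rho < 1 -> (forall m, \tr (M ^+ m) <= n%:R * rho ^+ m) ->
  exists2 S : R, \sum_(i < m) \tr (M ^+ i.+1) / i.+1%:R @[m --> \oo] --> S &
    Num.sqrt (\det (1%:M - M)) = expR (- (2^-1 * S)).
Proof.
move=> /symmetric_spectrum[d [trd detd _]] /andP[rho0 rho1] trM.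
have d1 i : `|d i| < 1.
  rewrite ltNge; apply/negP => di.
  (* In an even power all terms of the trace are nonnegative, so one eigenvalue of modulus at least
     1 keeps the trace at least 1, while n rho^(2m) tends to 0. *)
  have /cvgrPdist_lt/(_ _ ltr01)[m _ /(_ (m + m)%N)] := @cvg_geometric R n%:R rho
    ltac:(by rewrite ger0_norm).
  rewrite /= leq_addr sub0r normrN => /(_ isT).
  rewrite ger0_norm; last by rewrite mulr_ge0 ?exprn_ge0.
  apply/negP; rewrite -leNgt; apply: le_trans (trM _).
  rewrite trd (bigD1 i)//= -[leLHS]addr0 lerD//.
    by rewrite addnn -muln2 mulnC exprM -(real_normK (num_real _)) !exprn_ege1.
  by apply: sumr_ge0 => j _; rewrite exprD -expr2 sqr_ge0.
exists (\sum_i - ln (1 - d i)); last by rewrite detd; exact: sqrt_prod_log.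
rewrite (_ : (fun m => _) =
    (fun m => \sum_j \sum_(i < m) d j ^+ i.+1 / i.+1%:R)); last first.
  apply/funext => m; rewrite exchange_big/=.
  by apply: eq_bigr => i _; rewrite trd mulr_suml.
by apply: cvg_big => [|j _]; [exact: add_continuous|exact: cvg_log_series].
Qed.

End LogDet.

(** * The spectral radius and integrable weights *)

Section SpectralRadius.
Variable R : realType.

Lemma eigenvalue_le_spectral_radius n (M : 'M[R]_n) (z : R[i]) :
  eigenvalue (map_mx (real_complex R) M) z ->
  ComplexField.Normc.normc z <= spectral_radius M.
Proof.
move=> zM; apply: ub_le_sup; last by exists z.
have [r Er] := closed_field_poly_normal (char_poly (map_mx (real_complex R) M)).
(* The supremum needs an upper bound: all eigenvalues are among the roots [r] of the characteristic
   polynomial, so the sum of their moduli will do. *)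
exists (\sum_(y <- r) ComplexField.Normc.normc y) => _ [y /= yM <-].
have yr : y \in r.
  move: yM; rewrite eigenvalue_root_char Er rootZ ?root_prod_XsubC//.
  by rewrite lead_coef_eq0 monic_neq0// char_poly_monic.
rewrite (big_rem y)//= lerDl sumr_ge0// => u _.
by case: u => a b; rewrite /ComplexField.Normc.normc sqrtr_ge0.
Qed.

(** The maximum with 0 makes the base nonnegative at sight, even when n = 0 and there are no
    eigenvalues. *)
Lemma trace_exp_le_spectral_radius n (M : 'M[R]_n) m : M^T = M ->
  \tr (M ^+ m) <= n%:R * Num.max 0 (spectral_radius M) ^+ m.
Proof.
move=> /symmetric_spectrum[d [-> _ dM]].
rewrite -[n in n%:R]card_ord mulr_natl -sumr_const; apply: ler_sum => i _.
rewrite (le_trans (ler_norm _))// normrX lerXn2r ?nnegrE ?le_max ?lexx//.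
apply/orP; right; have := eigenvalue_le_spectral_radius (dM i).
by rewrite /ComplexField.Normc.normc /= expr0n addr0 sqrtr_sqr.
Qed.

Variables (A : finType) (theta : edge A -> R).

Lemma weight_mx_sym : (weight_mx theta)^T = weight_mx theta.
Proof.
apply/matrixP => i j; rewrite !mxE /dir_weight eq_sym.
by rewrite edge_ofC.
Qed.

Lemma dir_weight_norm x y : dir_weight (Num.norm \o theta) x y = `|dir_weight theta x y|.
Proof. by rewrite /dir_weight; case: ifP => // _; rewrite normrM normfV normr_nat. Qed.

Lemma weight_mx_norm : weight_mx (Num.norm \o theta) = map_mx Num.norm (weight_mx theta).
Proof. by apply/matrixP => i j; rewrite !mxE dir_weight_norm. Qed.

Lemma path_weight_norm s : path_weight (Num.norm \o theta) s = `|path_weight theta s|.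
Proof.
by rewrite /path_weight normr_prod; apply: eq_bigr => p _; rewrite dir_weight_norm.
Qed.

(** Triangle inequality in the expansion of the trace over rooted loops; the power 0 is apart
    because loops have at least one step. *)
Lemma trace_weight_mx_norm m :
  `|\tr (weight_mx theta ^+ m)| <= \tr (weight_mx (Num.norm \o theta) ^+ m).
Proof.
case: m => [|m]; first by rewrite !expr0 mxtrace1 normr_nat.
rewrite !trace_weight_mx (le_trans (ler_norm_sum _ _ _))//.
by apply: ler_sum => t _; rewrite path_weight_norm.
Qed.

Hypothesis theta_int : integrable_weight theta.

Let rho := Num.max 0 (spectral_radius (map_mx Num.norm (weight_mx theta))).

Lemma integrable_trace_bound : exists2 r : R, 0 <= r < 1 &
  forall m, \tr (weight_mx (Num.norm \o theta) ^+ m) <= #|A|%:R * r ^+ m.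
Proof.
exists rho; first by rewrite le_max lexx gt_max ltr01.
move=> m; rewrite /rho -weight_mx_norm; apply: trace_exp_le_spectral_radius.
by rewrite weight_mx_norm matrix.map_trmx weight_mx_sym.
Qed.

Lemma sqrt_det_weight_mx :
  exists2 S : R, \sum_(i < m) \tr (weight_mx theta ^+ i.+1) / i.+1%:R @[m --> \oo] --> S &
    Num.sqrt (\det (1%:M - weight_mx theta)) = expR (- (2^-1 * S)).
Proof.
have [r r01 tr_le] := integrable_trace_bound.
apply: (sqrt_det_trace_series weight_mx_sym r01) => m.
apply: le_trans (tr_le m); apply: le_trans (trace_weight_mx_norm m).
exact: ler_norm.
Qed.

End SpectralRadius.

(** * Absolutely convergent sums *)

Lemma maxrB_maxrN (R : realType) (x : R) : Num.max x 0 - Num.max (- x) 0 = x.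
Proof. by case: (leP x 0); case: (leP (- x) 0); lra. Qed.

Lemma finite_signed_sum (R : realType) (T : choiceType) (D : set T) (f : T -> R) :
  finite_set D -> signed_sum D f = \sum_(x <- fset_set D) f x.
Proof.
move=> finD; rewrite /signed_sum !esum_fset//.
have -> : (\sum_(i \in D) (EFin \o f)^\+%E i = (\sum_(i \in D) Num.max (f i) 0)%:E)%E.
  rewrite -fsumEFin//; apply: eq_fsbigr => x _.
  by rewrite funeposE /= EFin_max.
have -> : (\sum_(i \in D) (EFin \o f)^\-%E i = (\sum_(i \in D) Num.max (- f i) 0)%:E)%E.
  rewrite -fsumEFin//; apply: eq_fsbigr => x _.
  by rewrite funenegE /= EFin_max.
rewrite /= !fsbig_finite//= -sumrB; apply: eq_bigr => x _.
by rewrite maxrB_maxrN.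
Qed.

(** * Sums over a set graded by finite levels *)

Section GradedSum.
Variables (R : realType) (T : choiceType) (len : T -> nat) (L : nat -> seq T).
Hypothesis uniqL : forall n, uniq (L n).
Hypothesis memL : forall n x, (x \in L n) = (len x == n).
Implicit Types f : T -> R.

Lemma esum_graded f : (forall x, 0 <= f x) ->
  \esum_(x in [set: T]) (f x)%:E =
  (\sum_(0 <= n <oo) (\sum_(x <- L n) f x)%:E)%E.
Proof.
move=> f0; have -> : [set: T] = \bigcup_n [set` L n].
  by apply/seteqP; split => // x _; exists (len x); rewrite //= memL.
rewrite nneseries_sum_bigcup//; last first.
  by move=> m n _ _ [x [/=]]; rewrite !memL => /eqP <- /eqP.
apply: eq_eseriesr => n _.
rewrite esum_fset//; last by move=> x _; rewrite lee_fin.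
by rewrite -fsbig_seq// sumEFin.
Qed.

Lemma summable_graded f (C : R) :
  (forall N, \sum_(n < N) \sum_(x <- L n) `|f x| <= C) ->
  summable [set: T] (EFin \o f).
Proof.
move=> fC; rewrite /summable (eq_esum (b := fun x => `|f x|%:E))//.
rewrite esum_graded//; apply: le_lt_trans (ltry C); apply: lime_le.
  by apply: is_cvg_nneseries => n _ _; rewrite lee_fin sumr_ge0.
by apply: nearW => N; rewrite sumEFin lee_fin big_mkord.
Qed.

Lemma cvg_graded f : (forall x, 0 <= f x) ->
  (\esum_(x in [set: T]) (f x)%:E < +oo)%E ->
  \sum_(n < N) \sum_(x <- L n) f x @[N --> \oo] -->
  fine (\esum_(x in [set: T]) (f x)%:E).
Proof.
move=> f0 fin.
rewrite (_ : (fun N => _) =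
    fine \o (fun N => \sum_(0 <= n < N) (\sum_(x <- L n) f x)%:E)%E); last first.
  by apply/funext => N /=; rewrite sumEFin /= big_mkord.
apply: fine_cvg; rewrite fineK; last first.
  by rewrite ge0_fin_numE//; apply: esum_ge0 => x _; rewrite lee_fin.
rewrite esum_graded//.
by apply: is_cvg_nneseries => n _ _; rewrite lee_fin sumr_ge0.
Qed.

(** Summability makes the sums of the positive and negative parts finite, so each is the limit of
    its partial sums by level; their difference is the limit for f. *)
Lemma signed_sum_graded f (S : R) : summable [set: T] (EFin \o f) ->
  \sum_(n < N) \sum_(x <- L n) f x @[N --> \oo] --> S ->
  signed_sum [set: T] f = S.
Proof.
move=> sumf cvgS.
have posE x : (EFin \o f)^\+%E x = (Num.max (f x) 0)%:E.
  by rewrite funeposE /= EFin_max.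
have negE x : (EFin \o f)^\-%E x = (Num.max (- f x) 0)%:E.
  by rewrite funenegE /= EFin_max.
have maxr_ge0 (a : R) : 0 <= Num.max a 0 by rewrite le_max lexx orbT.
have finp : (\esum_(x in [set: T]) (Num.max (f x) 0)%:E < +oo)%E.
  apply: le_lt_trans sumf; apply: le_esum => x _.
  by rewrite /= lee_fin ge_max ler_norm normr_ge0.
have finn : (\esum_(x in [set: T]) (Num.max (- f x) 0)%:E < +oo)%E.
  apply: le_lt_trans sumf; apply: le_esum => x _.
  by rewrite /= lee_fin ge_max -normrN ler_norm normr_ge0.
have cp := cvg_graded (fun x => maxr_ge0 (f x)) finp.
have cn := cvg_graded (fun x => maxr_ge0 (- f x)) finn.
rewrite /signed_sum (eq_esum (fun x _ => posE x)) (eq_esum (fun x _ => negE x)).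
rewrite fineB ?ge0_fin_numE//; try by apply: esum_ge0 => x _; rewrite lee_fin.
have := cvgB cp cn; rewrite (_ : _ - _ = (fun N => \sum_(n < N) \sum_(x <- L n) f x)).
  by move=> cpn; exact: (cvg_unique (@Rhausdorff R) (cpn _) cvgS).
apply/funext => N; rewrite !fctE -sumrB; apply: eq_bigr => n _.
by rewrite -sumrB; apply: eq_bigr => x _; rewrite maxrB_maxrN.
Qed.

End GradedSum.

(** * Exponential bounds for sums over multisets *)

Lemma exp_partial_sum_le (R : realType) (x : R) n : 0 <= x ->
  \sum_(i < n) x ^+ i / i`!%:R <= expR x.
Proof.
move=> x0; have nd : {homo series (exp_coeff x) : m n / (m <= n)%N >-> m <= n}.
  by apply: nondecreasing_series => i _ _; rewrite divr_ge0 ?exprn_ge0.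
have := nondecreasing_cvgn_le nd (is_cvg_series_exp_coeff x) n.
by rewrite /series /= big_mkord.
Qed.

(** The multisets in X live on a finite set S with multiplicities at most some K, so their terms are
    among those of the expanded product over S of sum_(j <= K) b(x)^j / j!, which is at most exp
    M. *)
Lemma sum_mset_exp_le (R : realType) (T : choiceType) (b : T -> R) (M : R)
    (X : {fset {mset T}}) : (forall x, 0 <= b x) ->
  (forall S : {fset T}, \sum_(x <- S) b x <= M) ->
  \sum_(N <- X) \prod_(x <- finsupp N) (b x ^+ N x / (N x)`!%:R) <= expR M.
Proof.
move=> b0 bM.
pose S := (\bigcup_(N <- X) finsupp N)%fset.
have NS N : N \in X -> (finsupp N `<=` S)%fset.
  by move=> NX; apply: bigfcup_sup.
pose K := (\sum_(N <- X) \sum_(x <- S) N x)%N.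
have NK N x : N \in X -> x \in S -> (N x <= K)%N.
  move=> NX xS; rewrite /K (big_fsetD1 N)//= (big_fsetD1 x xS)/=.
  by rewrite -addnA leq_addr.
pose p (x : S) (j : 'I_K.+1) : R := b (val x) ^+ j / j`!%:R.
pose g (N : {mset T}) : {ffun S -> 'I_K.+1} := [ffun x => inord (N (val x))].
have gE N x : N \in X -> g N x = N (val x) :> nat.
  by move=> NX; rewrite ffunE inordK// ltnS NK// fsvalP.
have p0 x j : 0 <= p x j by rewrite divr_ge0 ?exprn_ge0.
have ginj : {in X &, injective g}.
  move=> N N' NX N'X gNN'; apply/msetP => x.
  have [xS|xS] := boolP (x \in S).
    by rewrite -[x]/(val [` xS]%fset) -!gE// gNN'.
  by rewrite !fsfun_dflt//; apply: contra xS; exact/fsubsetP/NS.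
have -> : \sum_(N <- X) \prod_(x <- finsupp N) (b x ^+ N x / (N x)`!%:R) =
    \sum_(h <- [seq g N | N <- X]) \prod_x p x (h x).
  rewrite big_map; apply: eq_big_seq => N NX.
  rewrite (big_fset_incl _ (NS _ NX))/=; last first.
    by move=> x _ xN; rewrite fsfun_dflt// expr0 divr1.
  rewrite big_seq_fsetE/=.
  by apply: eq_bigr => x _; rewrite /p gE.
apply: (@le_trans _ _ (\sum_(h : {ffun S -> 'I_K.+1}) \prod_x p x (h x))).
  rewrite big_uniq ?map_inj_in_uniq ?fset_uniq//=.
  rewrite [leRHS](bigID (mem [seq g N | N <- X]))/= lerDl sumr_ge0// => h _.
  exact: prodr_ge0.
rewrite -bigA_distr_bigA; apply: (@le_trans _ _ (\prod_(x : S) expR (b (val x)))).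
  apply: ler_prod => x _; rewrite sumr_ge0//=; exact: exp_partial_sum_le.
rewrite -expR_sum ler_expR; apply: le_trans (bM S).
by rewrite big_seq_fsetE.
Qed.

Lemma summable_fset_le (R : realType) (T : choiceType) (f : T -> R) (C : R) :
  (forall X : {fset T}, \sum_(x <- X) `|f x| <= C) ->
  summable [set: T] (EFin \o f).
Proof.
move=> fC; apply: le_lt_trans (ltry C); apply: ge_ereal_sup => _ /= [X [finX _] <-].
by rewrite fsbig_finite//= sumEFin lee_fin.
Qed.

Lemma summable_fset_bound (R : realType) (T : choiceType) (f : T -> R) :
  summable [set: T] (EFin \o f) ->
  exists C, forall X : {fset T}, \sum_(x <- X) `|f x| <= C.
Proof.
move=> sumf; have fin : \esum_(x in [set: T]) `|(f x)%:E|%E \is a fin_num.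
  by rewrite ge0_fin_numE//; exact: esum_ge0.
exists (fine (\esum_(x in [set: T]) `|(f x)%:E|%E)) => X.
rewrite -lee_fin fineK//; apply: esum_ge; exists [set` X] => //.
by rewrite fsbig_finite//= set_fsetK -sumEFin.
Qed.

(** * The loop soup *)

Section LoopSoup.
Variables (R : realType) (A : finType) (theta : edge A -> R).
Hypothesis theta_int : integrable_weight theta.
Implicit Types (t : R) (k : {ffun edge A -> nat}) (l : loop A).

Lemma loop_measure_norm l : loop_measure (Num.norm \o theta) l = `|loop_measure theta l|.
Proof.
rewrite /loop_measure !normrM normfV !normr_nat; congr (_ * _ * _).
by rewrite /loop_weight normr_prod; apply: eq_bigr => p _; rewrite dir_weight_norm.
Qed.

Lemma mem_loops_of_size_pred n l : (l \in loops_of_size A n) = ((loop_length l).-1 == n).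
Proof. by rewrite mem_loops_of_size -[loop_length l in LHS]prednK ?loop_length_gt0. Qed.

Lemma uniq_loops_of_size n : uniq (loops_of_size A n).
Proof. exact: undup_uniq. Qed.

(** For |theta| the loops of length n + 1 have total measure tr(|Q|^(n+1)) / (n + 1) <= #|A| r^n, a
    convergent geometric series. *)
Lemma summable_loop_measure : summable [set: loop A] (EFin \o loop_measure theta).
Proof.
have [r /andP[r0 r1] tr_le] := integrable_trace_bound theta_int.
apply: (summable_graded uniq_loops_of_size mem_loops_of_size_pred
  (C := #|A|%:R / (1 - r))).
move=> N; apply: (@le_trans _ _ (\sum_(n < N) #|A|%:R * r ^+ n)).
  apply: ler_sum => n _.
  under eq_bigr do rewrite -loop_measure_norm.
  rewrite sum_loop_measure ler_pdivrMr//.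
  apply: le_trans (tr_le _) _; rewrite -mulrA ler_wpM2l//.
  rewrite exprS mulrC ler_wpM2l ?exprn_ge0//.
  by rewrite (le_trans (ltW r1))// ler1n.
rewrite -mulr_sumr ler_wpM2l// -[leRHS]div1r ler_pdivlMr ?subr_gt0//.
have := subrX1 r N; rewrite -[r - 1]opprB mulNr => /eqP.
rewrite eq_sym eqr_oppLR opprB mulrC => /eqP ->.
by rewrite lerBlDr lerDl exprn_ge0.
Qed.

Lemma summable_soup t : summable [set: {mset loop A}] (EFin \o soup theta t).
Proof.
have [C mC] := summable_fset_bound summable_loop_measure.
set E := expR (- (t * signed_sum [set: loop A] (loop_measure theta))).
apply: (summable_fset_le (C := E * expR (`|t| * C))) => X.
have -> : \sum_(N <- X) `|soup theta t N| =
    E * \sum_(N <- X) \prod_(l <- finsupp N)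
        (`|t * loop_measure theta l| ^+ N l / (N l)`!%:R).
  rewrite mulr_sumr; apply: eq_bigr => N _.
  rewrite /soup normrM -/E gtr0_norm ?expR_gt0// normr_prod; congr (_ * _).
  by apply: eq_bigr => l _; rewrite normrM normrX normfV normr_nat.
rewrite ler_wpM2l ?expR_ge0//; apply: sum_mset_exp_le => // S.
by under eq_bigr do rewrite normrM; rewrite -mulr_sumr ler_wpM2l.
Qed.

Lemma current_soupE t k : current_soup theta t k =
  expR (- (t * signed_sum [set: loop A] (loop_measure theta))) * current_weight theta t k.
Proof.
rewrite /current_soup finite_signed_sum; last exact: finite_msets_of_current.
by rewrite /current_weight mulr_sumr.
Qed.

Lemma local_time_degree k x : local_time R k x = (degree k x)%:R / 2.
Proof. by rewrite /local_time -natr_sum mulrC. Qed.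

Lemma current_degree_even k : is_current R k -> forall x, ~~ odd (degree k x).
Proof.
move=> kcur x; have := kcur x; rewrite local_time_degree => /intrP[z].
move=> /(congr1 (fun y => y * 2)); rewrite divfK ?pnatr_eq0//.
rewrite -[2]/(2%:~R) -[(degree k x)%:R]/((degree k x)%:Z%:~R) -intrM.
by move=> /intr_inj; lia.
Qed.

(** At d = 2n, the function w(n) of the overview. *)
Definition half_gamma (d : nat) : R := Gamma (d%:R / 2 + 2^-1) / Num.sqrt pi.

Lemma current_weight_half k : (forall x, ~~ odd (degree k x)) ->
  current_weight theta 2^-1 k =
  (\prod_x half_gamma (degree k x)) * monomial theta k.
Proof.
have w0 : half_gamma 0 = 1.
  rewrite /half_gamma mul0r add0r Gamma_half divff//.
  by rewrite gt_eqF// sqrtr_gt0 pi_gt0.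
have wSS d : ~~ odd d ->
    half_gamma d.+2 = d.+1%:R / 2 * half_gamma d.
  move=> dE; rewrite /half_gamma mulrA; congr (_ / _).
  have -> : d = (d./2).*2 by rewrite even_halfK.
  have half m : (m.*2)%:R / 2 = m%:R :> R.
    by rewrite -muln2 natrM mulfK// pnatr_eq0.
  have halfS m : (m.*2).+1%:R / 2 = m%:R + 2^-1 :> R.
    by rewrite -natr1 mulrDl half div1r.
  by rewrite halfS -doubleS !half Gamma_half_rec.
exact: (wick_recursion w0 wSS (current_weight0 theta 2^-1)
  (@current_weight_rec R A theta 2^-1) erefl).1.
Qed.

End LoopSoup.

Theorem theorem2 (R : realType) (A : finType) (theta : edge A -> R)
    (htheta : integrable_weight theta) :
  [/\ summable [set: loop A] (EFin \o loop_measure theta),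
      summable [set: {mset loop A}] (EFin \o soup theta 2^-1) &
      forall k : {ffun edge A -> nat}, is_current R k ->
        current_soup theta 2^-1 k =
          Num.sqrt (\det (1%:M - weight_mx theta)) *
          (\prod_(x : A) (Gamma (local_time R k x + 2^-1) / Num.sqrt pi)) *
          (\prod_(e : edge A) ((k e)`!%:R)^-1) *
          \prod_(e : edge A) theta e ^+ k e].
Proof.
split; first exact: summable_loop_measure.
  exact: summable_soup.
move=> k /current_degree_even kE.
have [S cvgS ->] := sqrt_det_weight_mx htheta.
(* The loops of length n + 1 contribute the n-th term of the trace series, so its limit is
   m(L(A)). *)
have -> : S = signed_sum [set: loop A] (loop_measure theta).
  apply/esym/(signed_sum_graded (@uniq_loops_of_size A) (@mem_loops_of_size_pred A)).
    exact: summable_loop_measure.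
  by under eq_cvg do under eq_bigr do rewrite sum_loop_measure.
have -> : \prod_x (Gamma (local_time R k x + 2^-1) / Num.sqrt pi) =
    \prod_x half_gamma R (degree k x).
  by apply: eq_bigr => x _; rewrite local_time_degree.
by rewrite current_soupE (current_weight_half theta kE) /monomial !mulrA.
Qed.
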